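(* Let $\delta\in[0,\pi/2)$, $x_0>0$, and let $f\in L_1\left(\mathbb{R}_+;\,e^{(\pi-2\delta)\tau}\,d\tau\right)$. Then the index transform $$(F_0f)(x)=\frac{e^x}{\pi}\int_0^\infty K_{i\tau}^2\left(\frac{x}{2}\right)f(\tau)\,d\tau,\qquad x>0,$$ is a bounded map $$F_0:\ L_1\left(\mathbb{R}_+;\,e^{(\pi-2\delta)\tau}\,d\tau\right)\to C\left([x_0,\infty)\right),$$ and it can be represented as a composition of the Laplace and Olevskii transforms, namely, for $x>0$, $$(F_0f)(x)=\int_0^\infty e^{-xt}\,G_0(t)\,dt,$$ where $$G_0(t)=\int_0^\infty {}_2F_1\left(\tfrac12-i\tau,\ \tfrac12+i\tau;\ 1;\ -t^2-2t\right)f(\tau)\,d\tau,\qquad t>0.$$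
   Context: Here $\mathbb{R}_+=(0,\infty)$, $K_\nu(x)$ is the modified Bessel (Macdonald) function, and ${}_2F_1$ is the Gauss hypergeometric function (analytically continued to the negative real axis in its argument). For a positive weight $\omega$, $L_1(\mathbb{R}_+;\omega(\tau)\,d\tau)$ is the weighted Lebesgue space with norm $\int_0^\infty|f(\tau)|\,\omega(\tau)\,d\tau$. The space $C([x_0,\infty))$ carries the norm $\sup_{x\ge x_0}|\cdot|$. *)

(* Defs.v *)
From HB Require Import structures.
From mathcomp Require Import all_boot all_order all_algebra.
From mathcomp Require Import complex.
From mathcomp Require Import all_classical all_reals all_analysis.

Set Implicit Arguments.
Unset Strict Implicit.
Unset Printing Implicit Defensive.

Import Order.TTheory GRing.Theory Num.Theory.
Import numFieldNormedType.Exports.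
Import ComplexField.

Local Open Scope classical_set_scope.
Local Open Scope ring_scope.
Local Open Scope complex_scope.

Section ComplexPreliminaries.
Context {R : realType}.
Implicit Types (z : R[i]) (D : set R) (f : R -> R[i]).

Definition cmod z : R := Normc.normc z.

Definition cexp z : R[i] :=
  (expR (complex.Re z))%:C * (cos (complex.Im z) +i* sin (complex.Im z)).

Definition ccosh z : R[i] := (cexp z + cexp (- z)) / 2%:R.

Definition cmeasurable D f : Prop :=
  measurable_fun D (fun t => complex.Re (f t)) /\
  measurable_fun D (fun t => complex.Im (f t)).

Definition cintegrable D f : Prop :=
  (@lebesgue_measure R).-integrable D (fun t => (complex.Re (f t))%:E) /\
  (@lebesgue_measure R).-integrable D (fun t => (complex.Im (f t))%:E).

(* The value is meaningful only under [cintegrable D f]. *)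
Definition cintegral D f : R[i] :=
  Rintegral (@lebesgue_measure R) D (fun t => complex.Re (f t)) +i*
  Rintegral (@lebesgue_measure R) D (fun t => complex.Im (f t)).

(* [R[i]^o] selects the normed-space topology of the complex plane. *)
Definition power_series_at (u : nat -> R[i]) (z0 z : R) (s : R[i]) : Prop :=
  series (fun n => (u n * ((z - z0)%:C) ^+ n : R[i]^o)) @ \oo --> (s : R[i]^o).

Definition real_analytic_on D f : Prop :=
  forall z0 : R, D z0 -> exists (u : nat -> R[i]) (r : R), 0 < r /\
    forall z : R, `|z - z0| < r -> power_series_at u z0 z (f z).

End ComplexPreliminaries.

Section SpecialFunctions.
Context {R : realType}.

(* K_nu(x) = \int_0^oo e^{- x cosh u} cosh(nu u) du, for x > 0 and any complex
   order nu. *)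
Definition macdonald (nu : R[i]) (x : R) : R[i] :=
  cintegral `]0, +oo[ (fun u : R =>
    cexp (- (x%:C * ccosh u%:C)) * ccosh (nu * u%:C)).

Definition pochhammer (a : R[i]) (n : nat) : R[i] := \prod_(k < n) (a + k%:R).

Definition gauss_coef (a b c : R[i]) (n : nat) : R[i] :=
  pochhammer a n * pochhammer b n / (pochhammer c n * n`!%:R).

(* [g] is the Gauss series on ]-1, 1[, continued analytically along the real
   axis to ]-oo, 1[; by the identity theorem this determines [g] on ]-oo, 1[. *)
Definition is_hyp2F1 (a b c : R[i]) (g : R -> R[i]) : Prop :=
  real_analytic_on `]-oo, 1[ g /\
  forall z : R, `|z| < 1 -> power_series_at (gauss_coef a b c) 0 z (g z).

(* Intended for z < 1 only; the default value of [xget] is used only when no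
   continuation exists. *)
Definition hyp2F1 (a b c : R[i]) : R -> R[i] :=
  xget (fun=> 0) [set g | is_hyp2F1 a b c g].

End SpecialFunctions.

Section Spaces.
Context {R : realType}.
Implicit Types (w : R -> R) (f : R -> R[i]).

Definition L1_norm w f : \bar R :=
  (\int[@lebesgue_measure R]_(tau in `]0%R, +oo[) (cmod (f tau) * w tau)%:E)%E.

(* Representatives of the classes of the weighted space on ]0, +oo[. *)
Definition in_L1 w f : Prop :=
  cmeasurable `]0, +oo[ f /\ (L1_norm w f < +oo)%E.

Definition in_C (x0 : R) (g : R -> R[i]) : Prop :=
  {within `[x0, +oo[, continuous (g : R -> R[i]^o)}.

Definition sup_norm (x0 : R) (g : R -> R[i]) : \bar R :=
  ereal_sup [set (cmod (g x))%:E | x in `[x0, +oo[].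

(* Linearity and the bound together make [T] compatible with equality almost
   everywhere, so it does act on classes. *)
Definition bounded_L1_C w (x0 : R) (T : (R -> R[i]) -> R -> R[i]) : Prop :=
  [/\ forall f, in_L1 w f -> in_C x0 (T f),
      forall (a : R[i]) f g, in_L1 w f -> in_L1 w g -> forall x, x0 <= x ->
        T (fun tau => a * f tau + g tau) x = a * T f x + T g x
    & exists M : R, forall f, in_L1 w f ->
        (sup_norm x0 (T f) <= M%:E * L1_norm w f)%E].

End Spaces.

Section Transforms.
Context {R : realType}.
Implicit Types (f G : R -> R[i]).

Definition index_kernel (x tau : R) : R[i] := macdonald (tau *i) (x / 2) ^+ 2.

Definition index_transform f (x : R) : R[i] :=
  (expR x / pi)%:C *
  cintegral `]0, +oo[ (fun tau => index_kernel x tau * f tau).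

Definition olevskii_kernel (t tau : R) : R[i] :=
  hyp2F1 (2^-1 -i* tau) (2^-1 +i* tau) 1 (- t ^+ 2 - 2 * t).

Definition olevskii_transform f (t : R) : R[i] :=
  cintegral `]0, +oo[ (fun tau => olevskii_kernel t tau * f tau).

Definition laplace_kernel (x t : R) : R[i] := (expR (- (x * t)))%:C.

Definition laplace_transform G (x : R) : R[i] :=
  cintegral `]0, +oo[ (fun t => laplace_kernel x t * G t).

End Transforms.

(* Main.v *)
Require Import Defs.
From HB Require Import structures.
From mathcomp Require Import all_boot all_order all_algebra.
From mathcomp Require Import complex.
From mathcomp Require Import all_classical all_reals all_analysis.
From mathcomp Require Import measurable_realfun ring lra.
Import Order.TTheory GRing.Theory Num.Theory.
Import numFieldNormedType.Exports.
Set Implicit Arguments.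
Unset Strict Implicit.
Unset Printing Implicit Defensive.
Local Open Scope classical_set_scope.
Local Open Scope ring_scope.

(** The kernel of the index transform is the Laplace transform of the Olevskii kernel:
    for [x > 0],
      [expR x / pi * K_(i tau)(x / 2) ^ 2
         = int_0^oo expR (- x t) * F(1/2 - i tau, 1/2 + i tau; 1; - t ^ 2 - 2 t) dt].
    The Gauss function on the right is bounded by 1 and a function of the weighted space
    is integrable, the weight being at least 1, so Fubini's theorem gives the composition
    formula ([laplace_olevskii]). The transform is then the Laplace integral of a function
    bounded by the norm of [f], hence bounded by that norm over [x] and Lipschitz as a
    function of [1 / x]; this gives the bounded map and the continuity of its values.

    Both properties of the Gauss function come from one integral, that of Mehler and
    Dirichlet. With [m = tan theta],
      [conical tau s = 2 / pi * int_0^oo mehler tau (s * m / sqrt (1 + m ^ 2))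
         dm / (1 + m ^ 2)],
    where [mehler tau w = cos (2 tau asinh w) / sqrt (1 + w ^ 2)] is bounded by 1. To see
    that it is the analytic continuation of the Gauss series at [- s ^ 2], one differentiates
    under the integral sign to find the hypergeometric equation ([conical_ode]). An energy
    estimate at the singular point 0 identifies the two on the disc of convergence
    ([conical_gauss]). At regular points the solutions are sums of power series
    ([hyp_ode_analytic]), so that the function glued from both formulas is analytic
    on ]-oo, 1[ ([hypR_analytic]), and it is the only continuation by the identity theorem
    ([analytic_continuation_unique]).

    For the Laplace representation ([bessel_integral_sqr]), the square of
    [K_(i tau)(x / 2) = int_0^oo expR (- x / 2 * cosh u) * cos (tau u) du] is a double
    integral over the plane. The rotation [u = p + q], [v = p - q] turns the exponent into
    [- x cosh p cosh q] and the two cosines into [cos (2 tau p)] and [cos (2 tau q)]. The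
    coordinates [X = sinh p], [Y = cosh p sinh q] make the exponential a function of
    [s = sqrt (X ^ 2 + Y ^ 2)] alone; in polar coordinates the angular integral is the one
    that defines [conical tau s], and [t = sqrt (1 + s ^ 2) - 1] leaves a Laplace integral.
    All these changes of variables are made under iterated integrals of nonnegative
    functions: the cosine is replaced by 1 plus the cosine, and the case [tau = 0] is
    subtracted at the end. *)

(** * Real power series *)
Section PowerSeries.
Context {R : realType}.
Implicit Types (c d : R^nat) (x z rho : R).

Definition psum c x : R := limn (pseries c x).

(** Cauchy's estimate at radius [rho]. Unlike convergence at one point, it passes to
    the derived series at the price of a smaller radius. *)
Definition coef_bound c rho := exists C, forall n, `|c n| * rho ^+ n <= C.

Lemma cvg_pseries c rho x : coef_bound c rho -> `|x| < rho ->
  pseries c x @ \oo --> psum c x.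
Proof.
move=> [C Cc] xrho; apply: normed_cvg.
have rho0 : 0 < rho by exact: le_lt_trans xrho.
apply: (@series_le_cvg _ _ (geometric C (`|x| / rho))) => [n|n|n|].
- exact: normr_ge0.
- rewrite /geometric /= mulr_ge0 ?exprn_ge0 ?divr_ge0 ?(ltW rho0)//.
  by apply: le_trans (Cc 0%N); rewrite mulr_ge0 // exprn_ge0// ltW.
- rewrite /geometric /= normrM normrX expr_div_n mulrA mulrAC.
  by rewrite ler_wpM2r ?exprn_ge0 ?normr_ge0// ler_pdivlMr ?exprn_gt0.
- apply: is_cvg_geometric_series; rewrite ger0_norm ?divr_ge0 ?(ltW rho0)//.
  by rewrite ltr_pdivrMr// mul1r.
Qed.

Lemma coef_bound_cvg c x : cvgn (pseries c x) -> coef_bound c `|x|.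
Proof.
move=> /cvg_series_bounded[K [_ Kc]]; exists (K + 1) => n.
by rewrite -normrX -normrM; apply: (Kc (K + 1)); rewrite ?ltrDl.
Qed.

(** Each of the [n.+1] terms of [1 + q + ... + q ^ n] is at least [q ^ n]. *)
Lemma linear_geometric_bound (q : R) n : 0 <= q < 1 ->
  n.+1%:R * q ^+ n <= (1 - q)^-1.
Proof.
move=> /andP[q0 q1].
have q10 : 0 < 1 - q by rewrite subr_gt0.
rewrite -[leRHS]mul1r ler_pdivlMr//.
apply: (@le_trans _ _ ((1 - q) * \sum_(i < n.+1) q ^+ i)).
  rewrite mulrC ler_wpM2l ?(ltW q10)//.
  rewrite -[n.+1 in leLHS]card_ord -sum1_card natr_sum mulr_suml.
  apply: ler_sum => i _; rewrite mul1r.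
  by apply: ler_wiXn2l => //; [exact: ltW|rewrite -ltnS].
by rewrite -opprB mulNr -subrX1 opprB lerBlDr lerDl exprn_ge0.
Qed.

(** The factor [n.+1] is absorbed by the ratio of the two radii. *)
Lemma coef_bound_diffs c rho rho' : 0 < rho' < rho -> coef_bound c rho ->
  coef_bound (pseries_diffs c) rho'.
Proof.
move=> /andP[r0 rr] [C Cc]; exists (C / rho * (1 - rho' / rho)^-1) => n.
have rho0 : 0 < rho by exact: lt_trans rr.
have q : 0 <= rho' / rho < 1.
  by rewrite divr_ge0 ?(ltW r0) ?(ltW rho0)//= ltr_pdivrMr// mul1r.
have := linear_geometric_bound n q.
rewrite /pseries_diffs normrM ger0_norm// => lin.
have -> : n.+1%:R * `|c n.+1| * rho' ^+ n =
    (`|c n.+1| * rho ^+ n.+1) / rho * (n.+1%:R * (rho' / rho) ^+ n).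
  rewrite exprS expr_div_n; field.
  by rewrite expf_neq0 ?gt_eqF.
apply: ler_pM => //.
- by rewrite divr_ge0 ?mulr_ge0 ?exprn_ge0 ?(ltW rho0).
- by rewrite mulr_ge0 ?exprn_ge0 //; case/andP: q.
- by rewrite ler_wpM2r// invr_ge0 ltW.
Qed.

(** Termwise differentiation asks for convergence of the series and of its first two
    derived series at a common point, hence the intermediate radii. *)
Lemma is_derive_psum c rho x : coef_bound c rho -> `|x| < rho ->
  is_derive x 1 (psum c) (psum (pseries_diffs c) x).
Proof.
move=> cb xrho.
(* Equally spaced radii from [`|x|] at [i = 0] to [rho] at [i = 4]: each passage to a
   derived series, and the final evaluation, uses up one step. *)
pose r i : R := `|x| + (rho - `|x|) * i%:R / 4.
have rx : 0 < rho - `|x| by rewrite subr_gt0.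
have x0 := normr_ge0 x.
have cb3 : coef_bound (pseries_diffs c) (r 3%N).
  apply: coef_bound_diffs cb; rewrite /r; apply/andP; split; lra.
have cb2 : coef_bound (pseries_diffs (pseries_diffs c)) (r 2%N).
  apply: coef_bound_diffs cb3; rewrite /r; apply/andP; split; lra.
have r1 : `|r 1%N| = r 1%N by rewrite ger0_norm// /r; lra.
apply: (@pseries_snd_diffs _ _ (r 1%N)).
- by apply/cvgP/(cvg_pseries cb); rewrite r1 /r; lra.
- by apply/cvgP/(cvg_pseries cb3); rewrite r1 /r; lra.
- by apply/cvgP/(cvg_pseries cb2); rewrite r1 /r; lra.
- by rewrite r1 /r; lra.
Qed.

Lemma psum0 c : psum c 0 = c 0%N.
Proof.
apply/cvg_lim => //; rewrite -cvg_shiftS.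
rewrite (_ : (fun _ => _) = cst (c 0%N)); first exact: cvg_cst.
apply/funext => n; rewrite /pseries /series/= big_nat_recl//= expr0 mulr1.
by rewrite big1 ?addr0// => i _; rewrite expr0n mulr0.
Qed.

Lemma cvg_pseries_mulX d x l : pseries (pseries_diffs d) x @ \oo --> l ->
  pseries (fun n => n%:R * d n) x @ \oo --> x * l.
Proof.
move=> cd; rewrite -cvg_shiftS.
rewrite (_ : (fun _ => _) = (fun n => x * pseries (pseries_diffs d) x n)).
  by apply: cvgM => //; exact: cvg_cst.
apply/funext => n; rewrite /pseries /series/= big_nat_recl//= !mul0r add0r.
rewrite mulr_sumr; apply: eq_bigr => i _.
by rewrite /pseries_diffs exprS; ring.
Qed.

(** The sum is continuous at 0, so its value there is its limit from the right. *)
Lemma pseries_head_eq0 c (e : R) : 0 < e ->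
  (forall x, 0 < x < e -> pseries c x @ \oo --> (0 : R)) -> c 0%N = 0.
Proof.
move=> e0 c0.
have e2 : 0 < e / 2 < e by lra.
have cb : coef_bound c (e / 2).
  have := @coef_bound_cvg c (e / 2); rewrite ger0_norm; last by lra.
  by apply; apply/cvgP/c0.
have : {for 0, continuous (psum c)}.
  apply: differentiable_continuous; apply/derivable1_diffP.
  have := @is_derive_psum c (e / 2) 0 cb.
  by rewrite normr0 => /(_ ltac:(lra))[].
rewrite /prop_for/continuous_at psum0 => /cvg_at_right_filter cc.
apply: (cvg_unique _ cc) => //.
apply: (@cvg_trans _ ((fun _ : R => (0 : R)) @ 0^'+)); last exact: cvg_cst.
apply: near_eq_cvg; near=> x; apply/esym/cvg_lim => //; apply: c0.
by apply/andP; split; near: x; [exact: nbhs_right_gt|exact: nbhs_right_lt].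
Unshelve. all: by end_near. Qed.

(** Division by [x] shifts the coefficients, so they vanish one after the other. A
    one-sided neighbourhood is all that is known when a continuation along the axis
    comes from the right. *)
Lemma pseries_eq0 c (e : R) : 0 < e ->
  (forall x, 0 < x < e -> pseries c x @ \oo --> (0 : R)) -> forall n, c n = 0.
Proof.
move=> e0 + n; elim: n c => [|n IH] c c0; first exact: pseries_head_eq0 c0.
have c00 := pseries_head_eq0 e0 c0.
apply: (IH (fun n => c n.+1)) => x xe.
have x0 : x != 0 by case/andP: xe => /lt0r_neq0.
rewrite (_ : (pseries _ x) = (fun n => x^-1 * (pseries c x n.+1))).
  rewrite -(mulr0 x^-1); apply: cvgM; first exact: cvg_cst.
  by rewrite cvg_shiftS; exact: c0.
apply/funext => k; rewrite /pseries /series/= big_nat_recl//= c00 mul0r add0r.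
by rewrite mulr_sumr; apply: eq_bigr => i _; rewrite exprS; field.
Qed.

End PowerSeries.

(** * Power series solutions of the hypergeometric equation *)
Section HypergeometricODE.
Context {R : realType}.
Implicit Types (c : R^nat) (z h la : R) (y : R -> R).

(** What [hyp_ode] says about the coefficients of a solution in powers of [z - z0]; at
    the singular point 0 it degenerates to a two-term recurrence. *)
Definition ode_rec la (z0 : R) c := forall n,
  z0 * (1 - z0) * (n.+2%:R * n.+1%:R * c n.+2) + (1 - 2 * z0) * (n.+1%:R ^+ 2 * c n.+1)
  = (n%:R ^+ 2 + n%:R + la) * c n.

(** The hypergeometric equation with parameters [a], [b] and 1, where [a + b = 1] and
    [a * b = la]. *)
Definition hyp_ode la z (y0 y1 y2 : R) :=
  z * (1 - z) * y2 + (1 - 2 * z) * y1 - la * y0 = 0.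

(** Multiplication by [h] acts on a derived series as the Euler operator acts on
    coefficients, so the left-hand side is the limit of partial sums, and these vanish
    term by term by the recurrence. *)
Lemma psum_ode la z0 c rho h : ode_rec la z0 c -> coef_bound c rho ->
  `|h| < rho ->
  hyp_ode la (z0 + h) (psum c h) (psum (pseries_diffs c) h)
    (psum (pseries_diffs (pseries_diffs c)) h).
Proof.
move=> rc cb hrho.
set d := pseries_diffs c; set d2 := pseries_diffs d.
pose r i : R := `|h| + (rho - `|h|) * i%:R / 4.
have rx : 0 < rho - `|h| by rewrite subr_gt0.
have h0 := normr_ge0 h.
have cb3 : coef_bound d (r 3%N).
  by apply: coef_bound_diffs cb; rewrite /r; apply/andP; split; lra.
have cb2 : coef_bound d2 (r 2%N).
  by apply: coef_bound_diffs cb3; rewrite /r; apply/andP; split; lra.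
have C0 := cvg_pseries cb hrho.
have C1 : pseries d h @ \oo --> psum d h by apply: (cvg_pseries cb3); rewrite /r; lra.
have C2 : pseries d2 h @ \oo --> psum d2 h by apply: (cvg_pseries cb2); rewrite /r; lra.
have C3' := cvg_pseries_mulX C1.
have C3 := cvg_pseries_mulX C2.
pose f n := (n%:R - 1) * c n.
have C5 : pseries (fun n => n%:R * f n) h @ \oo --> h * (h * psum d2 h).
  apply: cvg_pseries_mulX; apply: cvg_trans C3; apply: near_eq_cvg.
  near=> n; apply: eq_bigr => i _; congr (_ * _).
  rewrite /pseries_diffs /f /d /pseries_diffs -[in RHS]natr1; ring.
have Z (k : R) (u : R^nat) l : u @ \oo --> l -> (fun n => k * u n) @ \oo --> k * l.
  by move=> ul; apply: cvgM => //; exact: cvg_cst.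
pose F n := z0 * (1 - z0) * pseries d2 h n +
  (1 - 2 * z0) * pseries (fun n => n%:R * d n) h n -
  pseries (fun n => n%:R * f n) h n + (1 - 2 * z0) * pseries d h n -
  2 * pseries (fun n => n%:R * c n) h n - la * pseries c h n.
have S : F @ \oo --> z0 * (1 - z0) * psum d2 h + (1 - 2 * z0) * (h * psum d2 h) -
    h * (h * psum d2 h) + (1 - 2 * z0) * psum d h - 2 * (h * psum d h)
    - la * psum c h.
  exact: cvgB (cvgB (cvgD (cvgB (cvgD (Z (z0 * (1 - z0)) _ _ C2)
    (Z (1 - 2 * z0) _ _ C3)) C5) (Z (1 - 2 * z0) _ _ C1)) (Z 2 _ _ C3'))
    (Z la _ _ C0).
suff F0 : F = cst 0.
  have : F @ \oo --> (0 : R) by rewrite F0; exact: cvg_cst.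
  move=> /(cvg_unique (@norm_hausdorff _ _) S) E; rewrite /hyp_ode -[RHS]E; ring.
apply/funext => n; rewrite /F /cst /pseries /series /=.
elim: n => [|n IH]; first by rewrite !big_nil; ring.
rewrite !big_nat_recr//=; set S0 := \sum_(0 <= i < n) _ in IH *.
set S1 := \sum_(0 <= i < n) _ in IH *; set S2 := \sum_(0 <= i < n) _ in IH *.
set S3 := \sum_(0 <= i < n) _ in IH *; set S4 := \sum_(0 <= i < n) _ in IH *.
set S5 := \sum_(0 <= i < n) _ in IH *.
rewrite -[RHS]addr0 -[X in _ = X + _]IH -[X in _ = _ + X](mul0r (h ^+ n)).
rewrite -(subrr ((n%:R ^+ 2 + n%:R + la) * c n)) -{1}rc.
rewrite /f /d2 /d /pseries_diffs -[n.+2%:R]natr1 -[n.+1%:R]natr1; ring.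
Unshelve. all: by end_near. Qed.

Fixpoint ode_coefs (la z0 a b : R) n : R * R :=
  if n is m.+1 then
    let: (u, v) := ode_coefs la z0 a b m in
    (v, ((m%:R ^+ 2 + m%:R + la) * u - (1 - 2 * z0) * (m.+1%:R ^+ 2 * v)) /
        (z0 * (1 - z0) * (m.+2%:R * m.+1%:R)))
  else (a, b).

(** Away from the singular points 0 and 1 the recurrence determines [c n.+2] and gives
    [`|c n.+2| <= A * (`|c n.+1| + `|c n|)], so that the coefficients grow at most like
    the powers of [1 + A]. *)
Lemma ode_rec_exists la (z0 a b : R) : z0 * (1 - z0) != 0 ->
  exists c rho, [/\ 0 < rho, ode_rec la z0 c, coef_bound c rho, c 0%N = a & c 1%N = b].
Proof.
set p0 := z0 * (1 - z0) => p0N0.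
pose c n := (ode_coefs la z0 a b n).1.
have cS n : (ode_coefs la z0 a b n).2 = c n.+1.
  by rewrite /c /=; case: ode_coefs.
have rc : ode_rec la z0 c.
  move=> n; rewrite -!cS /= -/p0.
  case E: (ode_coefs la z0 a b n) => [u v]/=.
  rewrite /c E /= -[n.+2%:R]natr1 -[n.+1%:R]natr1.
  have n0 : 0 <= n%:R :> R by [].
  have : (n%:R + 1 + 1 : R) != 0 by apply: lt0r_neq0; lra.
  have : (n%:R + 1 : R) != 0 by apply: lt0r_neq0; lra.
  by move=> h1 h2; field; rewrite h1 h2 p0N0.
pose A := (`|1 - 2 * z0| + (1 + `|la|)) / `|p0|.
have p0gt : 0 < `|p0| by rewrite normr_gt0.
have A0 : 0 <= A by rewrite divr_ge0// ?addr_ge0.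
have cn2 n : `|c n.+2| <= A * (`|c n.+1| + `|c n|).
  have n0 : 0 <= n%:R :> R by [].
  have D0 : 0 < n.+2%:R * n.+1%:R :> R by rewrite mulr_gt0.
  rewrite /A mulrAC ler_pdivlMr// -(ler_pM2l D0).
  have -> : n.+2%:R * n.+1%:R * (`|c n.+2| * `|p0|) =
      `|(n%:R ^+ 2 + n%:R + la) * c n - (1 - 2 * z0) * (n.+1%:R ^+ 2 * c n.+1)|.
    rewrite -rc addrK -/p0 !normrM [`|n.+1%:R|]ger0_norm// [`|n.+2%:R|]ger0_norm//.
    ring.
  apply: (le_trans (ler_normB _ _)).
  rewrite !normrM [`|n.+1%:R|]ger0_norm// -expr2.
  have h1 : `|n%:R ^+ 2 + n%:R + la| <= n.+2%:R * n.+1%:R * (1 + `|la|).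
    apply: (le_trans (ler_normD _ _)).
    rewrite ger0_norm; last by rewrite addr_ge0// exprn_ge0.
    rewrite -[n.+2%:R]natr1 -[n.+1%:R]natr1.
    have := normr_ge0 la; nra.
  have h2 : `|1 - 2 * z0| * n.+1%:R ^+ 2 <= n.+2%:R * n.+1%:R * `|1 - 2 * z0|.
    rewrite -[n.+2%:R]natr1 -[n.+1%:R]natr1.
    have := normr_ge0 (1 - 2 * z0); nra.
  have := normr_ge0 (c n); have := normr_ge0 (c n.+1).
  move=> q1 q0.
  have := ler_wpM2r q0 h1; have := ler_wpM2r q1 h2.
  have := mulr_ge0 (ltW D0) (mulr_ge0 (normr_ge0 (1 - 2 * z0)) q0).
  have : 0 <= n.+2%:R * n.+1%:R * ((1 + `|la|) * `|c n.+1|).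
    by rewrite !mulr_ge0// addr_ge0.
  move=> e1 e2 e3 e4; lra.
pose M := 1 + A.
have M1 : 1 <= M by rewrite /M lerDl.
have M0 : 0 < M by lra.
pose C := `|a| + `|b|.
have C0 : 0 <= C by rewrite addr_ge0.
have bnd n : `|c n| <= C * M ^+ n /\ `|c n.+1| <= C * M ^+ n.+1.
  elim: n => [|n [IH1 IH2]].
    rewrite expr0 expr1 /C /c /= mulr1; split; first by rewrite lerDl.
    have := normr_ge0 a; have := normr_ge0 b; nra.
  split=> //; apply: (le_trans (cn2 n)).
  have -> : C * M ^+ n.+2 = M ^+ 2 * (C * M ^+ n) by rewrite -[n.+2]addn2 exprD; ring.
  have k : 0 <= C * M ^+ n by rewrite mulr_ge0// exprn_ge0 ?(ltW M0).
  have IH2' : `|c n.+1| <= M * (C * M ^+ n) by rewrite mulrCA -exprS.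
  apply: (@le_trans _ _ (A * (M * (C * M ^+ n) + C * M ^+ n))).
    by rewrite ler_wpM2l// lerD.
  rewrite /M in k *; nra.
exists c, M^-1; split => //; first by rewrite invr_gt0.
exists C => n; rewrite exprVn ler_pdivrMr ?exprn_gt0//; exact: (bnd n).1.
Qed.

End HypergeometricODE.

(** * Uniqueness for linear second order equations *)
Section Uniqueness.
Context {R : realType}.
Implicit Types (f df u : R -> R) (a b x z : R).

Lemma is_derive_nincr f df a b : a <= b ->
  (forall z, a <= z <= b -> is_derive z 1 f (df z)) ->
  (forall z, a <= z <= b -> df z <= 0) -> f b <= f a.
Proof.
move=> ab fd df0.
have [] := @MVT_segment _ f df a b ab.
- by move=> z; rewrite in_itv/= => /andP[az zb]; apply: fd; rewrite !ltW.
- by apply: derivable_within_continuous => z; rewrite in_itv/= => /fd[].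
- move=> z; rewrite in_itv/= => /df0 dz E.
  by rewrite -subr_le0 E mulr_le0_ge0// subr_ge0.
Qed.

(** Gronwall's argument: [E = u ^ 2 + u1 ^ 2] satisfies [`|E'| <= L * E], so that
    [expR (- L * x) * E x] decreases to the right of [z0] and [expR (L * x) * E x]
    increases to its left, while [E] vanishes at [z0]. *)
Lemma linear_ode_unique u (u1 u2 : R -> R) (z0 e K : R) : 0 <= K ->
  (forall z, `|z - z0| < e -> is_derive z 1 u (u1 z)) ->
  (forall z, `|z - z0| < e -> is_derive z 1 u1 (u2 z)) ->
  (forall z, `|z - z0| < e -> `|u2 z| <= K * (`|u z| + `|u1 z|)) ->
  u z0 = 0 -> u1 z0 = 0 -> forall z, `|z - z0| < e -> u z = 0.
Proof.
move=> K0 du du1 bu uz0 u1z0 z zz0.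
pose E x := u x ^+ 2 + u1 x ^+ 2.
pose L := 1 + 3 * K.
have E0 x : 0 <= E x by rewrite addr_ge0 ?sqr_ge0.
pose F (s : R) x := expR (- s * L * x) * E x.
pose dF s x := expR (- s * L * x) * (2 * u x * u1 x + 2 * u1 x * u2 x - s * L * E x).
have dFP s x : `|x - z0| < e -> is_derive x 1 (F s) (dF s x).
  move=> xe; have D1 := du _ xe; have D2 := du1 _ xe.
  have D3 : is_derive x 1 (fun x => expR (- s * L * x)) (expR (- s * L * x) * (- s * L)).
    apply: is_derive1_comp; apply: is_derive_eq.
    by rewrite /GRing.scale/= mulr1.
  have D4 : is_derive x 1 E (2 * u x * u1 x + 2 * u1 x * u2 x).
    apply: is_derive_eq; rewrite /GRing.scale/=; ring.
  apply: is_derive_eq; rewrite /dF /GRing.scale/=; ring.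
have key x : `|x - z0| < e -> `|2 * u x * u1 x + 2 * u1 x * u2 x| <= L * E x.
  move=> xe; apply: (le_trans (ler_normD _ _)).
  have := bu _ xe; rewrite !normrM normr_nat /L /E.
  rewrite -(real_normK (num_real (u x))) -(real_normK (num_real (u1 x))).
  have := normr_ge0 (u x); have := normr_ge0 (u1 x); have := normr_ge0 (u2 x).
  set p := `|u x|; set q := `|u1 x|; set r := `|u2 x| => r0 q0 p0 rK.
  have : q * r <= q * (K * (p + q)) by rewrite ler_wpM2l.
  have : 0 <= (p - q) ^+ 2 by rewrite sqr_ge0.
  have : 0 <= K * (p - q) ^+ 2 by rewrite mulr_ge0// sqr_ge0.
  have : 0 <= K * p ^+ 2 by rewrite mulr_ge0// sqr_ge0.
  lra.
suff : E z <= 0.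
  move=> Ez; have /eqP : u z ^+ 2 = 0.
    apply/eqP; rewrite eq_le sqr_ge0 andbT; apply: le_trans Ez.
    by rewrite lerDl sqr_ge0.
  by rewrite sqrf_eq0 => /eqP.
have Ez0 : E z0 = 0 by rewrite /E uz0 u1z0 expr0n addr0.
have [lez|/ltW lez] := leP z0 z.
- have : F 1 z <= F 1 z0.
    apply: (@is_derive_nincr (F 1) (dF 1) z0 z lez) => x /andP[x0 xz].
      by apply: dFP; move: zz0; rewrite !ger0_norm ?subr_ge0//; lra.
    rewrite /dF pmulr_rle0 ?expR_gt0// mul1r subr_le0.
    apply: le_trans (key _ _); first exact: ler_norm.
    by move: zz0; rewrite !ger0_norm ?subr_ge0//; lra.
  by rewrite /F Ez0 mulr0 pmulr_rle0 ?expR_gt0.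
- have : - F (-1) z0 <= - F (-1) z.
    apply: (@is_derive_nincr (- F (-1)) (fun x => - dF (-1) x) z z0 lez) => x /andP[x0 xz].
      by apply: is_deriveN; apply: dFP; move: zz0; rewrite !ler0_norm ?subr_le0//; lra.
    rewrite /dF oppr_le0 pmulr_rge0 ?expR_gt0// !mulN1r mulNr opprK.
    rewrite -lerBlDr sub0r.
    apply: lerNnormlW; apply: key.
    by move: zz0; rewrite !ler0_norm ?subr_le0//; lra.
  by rewrite lerN2 /F Ez0 mulr0 pmulr_rle0 ?expR_gt0.
Qed.

End Uniqueness.

(** * Analyticity of solutions and the Gauss coefficients *)
Section Analyticity.
Context {R : realType}.
Implicit Types (y : R -> R) (z la tau : R).

Definition analytic_at y (z0 : R) := exists (c : R^nat) (r : R), 0 < r /\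
  forall z, `|z - z0| < r -> pseries c (z - z0) @ \oo --> y z.

(** Near a regular point the solution coincides with the power series solution that has
    the same value and the same slope there. *)
Lemma hyp_ode_analytic la (y y1 y2 : R -> R) (z0 e : R) :
  z0 != 0 -> z0 < 1 -> 0 < e ->
  (forall z, `|z - z0| < e -> is_derive z 1 y (y1 z)) ->
  (forall z, `|z - z0| < e -> is_derive z 1 y1 (y2 z)) ->
  (forall z, `|z - z0| < e -> hyp_ode la z (y z) (y1 z) (y2 z)) ->
  analytic_at y z0.
Proof.
move=> z00 z01 e0 dy dy1 ode.
have p0 : z0 * (1 - z0) != 0 by rewrite mulf_neq0// gt_eqF// subr_gt0.
have [c [rho [rho0 rc cb c0 c1]]] := ode_rec_exists la (y z0) (y1 z0) p0.
pose d : R := Num.min `|z0| (1 - z0).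
have az0 : 0 < `|z0| by rewrite normr_gt0.
have d0 : 0 < d by rewrite /d lt_min az0 subr_gt0.
pose r := Num.min (Num.min e rho) (d / 2).
have r0 : 0 < r by rewrite /r !lt_min e0 rho0/= divr_gt0.
exists c, r; split => // z zr.
have nbd x : `|x - z0| < r -> [/\ `|x - z0| < e, `|x - z0| < rho,
    `|x - z0| < `|z0| / 2 & `|x - z0| < (1 - z0) / 2].
  rewrite /r !lt_min => /andP[/andP[-> ->] h]; split => //.
    by apply: lt_le_trans h _; rewrite ler_wpM2r// /d ge_min lexx.
  by apply: lt_le_trans h _; rewrite ler_wpM2r// /d ge_min lexx orbT.
(* A lower bound of the leading coefficient [z * (1 - z)] on the chosen interval,
   which makes the equation of the form required by [linear_ode_unique]. *)
pose m := `|z0| / 2 * ((1 - z0) / 2).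
have m0 : 0 < m by rewrite /m !mulr_gt0// subr_gt0.
pose s x := psum c (x - z0).
pose s1 x := psum (pseries_diffs c) (x - z0).
pose s2 x := psum (pseries_diffs (pseries_diffs c)) (x - z0).
have cvgs x : `|x - z0| < r -> pseries c (x - z0) @ \oo --> s x.
  by move=> /nbd[_ xr _ _]; exact: (cvg_pseries cb).
have dsh (x : R) : is_derive x 1 (fun x : R => x - z0) 1.
  by apply: is_derive_eq; rewrite oppr0 addr0.
have ds x : `|x - z0| < r -> is_derive x 1 s (s1 x).
  move=> /nbd[_ xr _ _].
  have := @is_derive1_comp _ (psum c) (fun x => x - z0) x _ _
    (is_derive_psum cb xr) (dsh x).
  by rewrite mulr1.
have ds1 x : `|x - z0| < r -> is_derive x 1 s1 (s2 x).
  move=> /nbd[_ xr _ _].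
  have n0 := normr_ge0 (x - z0).
  have cb' : coef_bound (pseries_diffs c) ((`|x - z0| + rho) / 2).
    by apply: coef_bound_diffs cb; apply/andP; split; lra.
  have xr' : `|x - z0| < (`|x - z0| + rho) / 2 by lra.
  have := @is_derive1_comp _ (psum (pseries_diffs c)) (fun x => x - z0) x _ _
    (is_derive_psum cb' xr') (dsh x).
  by rewrite mulr1.
have odes x : `|x - z0| < r -> hyp_ode la x (s x) (s1 x) (s2 x).
  move=> /nbd[_ xr _ _]; have := psum_ode rc cb xr.
  by rewrite addrC subrK.
suff <- : s z = y z by exact: cvgs.
apply/eqP; rewrite -subr_eq0; apply/eqP.
apply: (@linear_ode_unique _ (s - y) (s1 - y1) (s2 - y2) z0 r
    ((1 + 4 * `|z0| + `|la|) / m)) => // [|x xr|x xr|x xr||].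
- by rewrite divr_ge0 ?(ltW m0)// !addr_ge0// mulr_ge0.
- have [xe _ _ _] := nbd _ xr; apply: is_deriveB; [exact: ds|exact: dy].
- have [xe _ _ _] := nbd _ xr; apply: is_deriveB; [exact: ds1|exact: dy1].
- have [xe _ xz0 xz1] := nbd _ xr.
  have := odes _ xr; have := ode _ xe; rewrite /hyp_ode !fctE => O1 O2.
  set u := s x - y x; set u1 := s1 x - y1 x; set u2 := s2 x - y2 x.
  have O : x * (1 - x) * u2 = la * u - (1 - 2 * x) * u1.
    have : x * (1 - x) * u2 - (la * u - (1 - 2 * x) * u1) = 0.
      by rewrite -[RHS](subrr 0) -{1}O2 -O1 /u /u1 /u2; ring.
    by move/subr0_eq.
  have x1 : `|z0| / 2 <= `|x|.
    have := ler_normB x (x - z0); rewrite opprB addrCA subrr addr0; lra.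
  have x1' : `|x| <= 2 * `|z0|.
    have := ler_normD (x - z0) z0; rewrite subrK; lra.
  have x2 : (1 - z0) / 2 <= `|1 - x|.
    apply: le_trans (ler_norm _); have := ler_norm (x - z0); lra.
  have x3 : `|1 - 2 * x| <= 1 + 4 * `|z0|.
    by have := ler_normB 1 (2 * x); rewrite normrM normr_nat normr1; lra.
  have mm : m <= `|x * (1 - x)|.
    by rewrite normrM; apply: ler_pM => //; lra.
  rewrite mulrAC ler_pdivlMr//.
  apply: (@le_trans _ _ (`|x * (1 - x)| * `|u2|)).
    by rewrite mulrC ler_wpM2r.
  rewrite -normrM O; apply: (le_trans (ler_normB _ _)); rewrite !normrM.
  have := normr_ge0 u; have := normr_ge0 u1; have := normr_ge0 la.
  move=> l0 a1 a0.
  have := ler_wpM2r a1 x3; have := mulr_ge0 l0 a1.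
  have : 0 <= (1 + 4 * `|z0|) * `|u| by rewrite mulr_ge0//; lra.
  lra.
- by rewrite !fctE /s subrr psum0 c0 subrr.
- by rewrite !fctE /s1 subrr psum0 /pseries_diffs c1 mul1r subrr.
Qed.

(** The Gauss coefficients for the parameters [1/2 - i tau], [1/2 + i tau] and 1: they
    are real because conjugate factors occur in pairs. *)
Definition conical_coef tau n : R :=
  (\prod_(k < n) ((k%:R + 2^-1) ^+ 2 + tau ^+ 2)) / n`!%:R ^+ 2.

Lemma conical_coefS tau n : n.+1%:R ^+ 2 * conical_coef tau n.+1 =
  ((n%:R + 2^-1) ^+ 2 + tau ^+ 2) * conical_coef tau n.
Proof.
rewrite /conical_coef big_ord_recr/= factS natrM; field.
by rewrite pnatr_eq0 -lt0n fact_gt0/= nat1r pnatr_eq0.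
Qed.

Lemma conical_coef_gt0 tau n : 0 < conical_coef tau n.
Proof.
rewrite /conical_coef divr_gt0 ?exprn_gt0 ?ltr0n ?fact_gt0//.
apply: prodr_gt0 => i _; rewrite ltr_wpDr ?sqr_ge0// exprn_gt0//.
Qed.

Lemma conical_coef_rec tau : ode_rec (4^-1 + tau ^+ 2) 0 (conical_coef tau).
Proof. by move=> n; rewrite conical_coefS; field. Qed.

(** The ratio of consecutive coefficients, [((n + 1/2) ^ 2 + tau ^ 2) / (n + 1) ^ 2], is
    at most 1 for large [n], so the coefficients eventually decrease. *)
Lemma conical_coef_bound tau : coef_bound (conical_coef tau) 1.
Proof.
pose n0 := Num.truncn (4^-1 + tau ^+ 2).
have dec n : (n0 <= n)%N -> conical_coef tau n.+1 <= conical_coef tau n.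
  move=> n0n.
  have p : 0 < n.+1%:R ^+ 2 :> R by rewrite exprn_gt0.
  rewrite -(ler_pM2l p) conical_coefS ler_wpM2r ?ltW ?conical_coef_gt0//.
  have : 4^-1 + tau ^+ 2 < n.+1%:R.
    apply: lt_le_trans (truncnS_gt _) _; rewrite ?ler_nat//.
  rewrite -[n.+1%:R]natr1; set t := tau ^+ 2; set v := n%:R; move=> h; nra.
pose M := \sum_(i < n0.+1) conical_coef tau i.
exists M => n; rewrite expr1n mulr1 gtr0_norm ?conical_coef_gt0//.
have small i : (i <= n0)%N -> conical_coef tau i <= M.
  rewrite -ltnS => i0; rewrite /M (bigD1 (Ordinal i0))//= lerDl sumr_ge0// => j _.
  exact/ltW/conical_coef_gt0.
have [|/ltnW n0n] := leqP n n0; first exact: small.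
rewrite -(subnK n0n); elim: (n - n0)%N => [|k IH]; first by rewrite add0n small.
by apply: le_trans IH; apply: dec; rewrite leq_addl.
Qed.

End Analyticity.

(** * Inverse hyperbolic sine *)
Section Hyperbolic.
Context {R : realType}.
Implicit Types (w u x : R).

Definition hypot1 w : R := Num.sqrt (1 + w ^+ 2).
Definition asinh w : R := ln (w + hypot1 w).
Definition coshR u : R := (expR u + expR (- u)) / 2.

Lemma hypot1_arg_gt0 w : 0 < 1 + w ^+ 2.
Proof. by rewrite ltr_wpDr// sqr_ge0. Qed.

Lemma hypot1_gt0 w : 0 < hypot1 w.
Proof. by rewrite sqrtr_gt0 hypot1_arg_gt0. Qed.

Lemma hypot1_neq0 w : hypot1 w != 0.
Proof. by rewrite gt_eqF// hypot1_gt0. Qed.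

Lemma sqr_hypot1 w : hypot1 w ^+ 2 = 1 + w ^+ 2.
Proof. by rewrite sqr_sqrtr// ltW// hypot1_arg_gt0. Qed.

Lemma hypot1_ge1 w : 1 <= hypot1 w.
Proof.
have : Num.sqrt 1 <= hypot1 w by rewrite ler_wsqrtr// lerDl sqr_ge0.
by rewrite sqrtr1.
Qed.

Lemma normr_lt_hypot1 w : `|w| < hypot1 w.
Proof. by rewrite /hypot1 -sqrtr_sqr ltr_sqrt ?hypot1_arg_gt0// ltrDr. Qed.

Lemma asinh_arg_gt0 w : 0 < w + hypot1 w.
Proof. by have := normr_lt_hypot1 w; rewrite ltr_norml => /andP[]; lra. Qed.

Lemma hypot1N w : hypot1 (- w) = hypot1 w.
Proof. by rewrite /hypot1 sqrrN. Qed.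

Lemma expR_asinh w : expR (asinh w) = w + hypot1 w.
Proof. by rewrite lnK// posrE asinh_arg_gt0. Qed.

Lemma asinhN w : asinh (- w) = - asinh w.
Proof.
apply: expR_inj; rewrite expRN !expR_asinh hypot1N.
apply: (mulIf (lt0r_neq0 (asinh_arg_gt0 w))).
rewrite mulVf ?lt0r_neq0 ?asinh_arg_gt0//.
have := sqr_hypot1 w; set h := hypot1 w => hw.
by transitivity (h ^+ 2 - w ^+ 2); [ring|rewrite hw; ring].
Qed.

Lemma asinh0 : asinh 0 = 0 :> R.
Proof. by rewrite /asinh /hypot1 add0r expr0n addr0 sqrtr1 ln1. Qed.

Lemma cosh_asinh w : coshR (asinh w) = hypot1 w.
Proof. by rewrite /coshR -asinhN !expR_asinh hypot1N; field. Qed.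

Lemma is_derive_hypot1 w : is_derive w 1 hypot1 (w / hypot1 w).
Proof.
have := hypot1_arg_gt0 w => h0.
have D : is_derive w 1 (fun w : R => 1 + w ^+ 2) (2 * w).
  by apply: is_derive_eq; rewrite /GRing.scale/=; ring.
have := @is_derive1_comp _ Num.sqrt (fun w : R => 1 + w ^+ 2) w _ _
  (is_derive1_sqrt h0) D.
rewrite -/(hypot1 w).
have -> : (2 * hypot1 w)^-1 * (2 * w) = w / hypot1 w by field; exact: hypot1_neq0.
by [].
Qed.

Lemma is_derive_asinh w : is_derive w 1 asinh (hypot1 w)^-1.
Proof.
have := asinh_arg_gt0 w => h0.
have D0 := is_derive_hypot1 w.
have D : is_derive w 1 (fun w : R => w + hypot1 w) (1 + w / hypot1 w).
  by apply: is_derive_eq.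
have := @is_derive1_comp _ (@ln R) (fun w : R => w + hypot1 w) w _ _ (is_derive1_ln h0) D.
have -> : (w + hypot1 w)^-1 * (1 + w / hypot1 w) = (hypot1 w)^-1.
  by field; rewrite hypot1_neq0 (gt_eqF h0).
by [].
Qed.

Lemma is_derive_continuous (f : R -> R) x l : is_derive x 1 f l ->
  {for x, continuous f}.
Proof.
by move=> [dfx _]; apply: differentiable_continuous; apply/derivable1_diffP.
Qed.

Lemma continuous_hypot1 : continuous hypot1.
Proof. by move=> w; exact: is_derive_continuous (is_derive_hypot1 w). Qed.

Lemma continuous_asinh : continuous asinh.
Proof. by move=> w; exact: is_derive_continuous (is_derive_asinh w). Qed.

Lemma coshRN u : coshR (- u) = coshR u.
Proof. by rewrite /coshR opprK addrC. Qed.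

Lemma coshRD_coshRB u x : coshR (u + x) + coshR (u - x) = 2 * coshR u * coshR x.
Proof. by rewrite /coshR opprD opprB !expRD; field. Qed.

Lemma continuous_coshR : continuous coshR.
Proof.
move=> w; apply: (@is_derive_continuous _ _ ((expR w - expR (- w)) / 2)).
rewrite /coshR; apply: is_derive_eq; rewrite /GRing.scale/=; ring.
Qed.

End Hyperbolic.

(** * The integrand of the conical functions *)
Section Mehler.
Context {R : realType}.
Implicit Types (tau w s m : R).

Definition mehler tau w : R := cos (2 * tau * asinh w) / hypot1 w.
Definition mehler1 tau w : R :=
  - (2 * tau * sin (2 * tau * asinh w) + w * mehler tau w) / (1 + w ^+ 2).
(** The second derivative of [mehler], read off from the equation
    [(1 + w ^ 2) y'' + 3 w y' + (1 + 4 tau ^ 2) y = 0] that [mehler] solves. *)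
Definition mehler2 tau w : R :=
  - (3 * w * mehler1 tau w + (1 + 4 * tau ^+ 2) * mehler tau w) / (1 + w ^+ 2).

Lemma is_derive_mehler tau w : is_derive w 1 (mehler tau) (mehler1 tau w).
Proof.
have D1 := is_derive_asinh w; have D2 := is_derive_hypot1 w.
have h0 := hypot1_neq0 w.
have DA : is_derive w 1 (fun w => 2 * tau * asinh w) (2 * tau / hypot1 w).
  by apply: is_derive_eq; rewrite /GRing.scale/=; ring.
have DC := @is_derive1_comp _ (@cos R) (fun w : R => 2 * tau * asinh w) w _ _ (is_derive_cos _) DA.
have DV := is_deriveV h0 D2.
apply: is_derive_eq; rewrite /mehler1 /mehler /= -sqr_hypot1 /GRing.scale/=.
by field.
Qed.

Lemma is_derive_mehler1 tau w : is_derive w 1 (mehler1 tau) (mehler2 tau w).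
Proof.
have D0 := is_derive_mehler tau w.
have D1 := is_derive_asinh w; have h0 := hypot1_neq0 w.
have DA : is_derive w 1 (fun w => 2 * tau * asinh w) (2 * tau / hypot1 w).
  by apply: is_derive_eq; rewrite /GRing.scale/=; ring.
have DS := @is_derive1_comp _ (@sin R) (fun w : R => 2 * tau * asinh w) w _ _ (is_derive_sin _) DA.
have w0 : 1 + w ^+ 2 != 0 by rewrite gt_eqF// hypot1_arg_gt0.
have DQ : is_derive w 1 (fun w : R => 1 + w ^+ 2) (2 * w).
  by apply: is_derive_eq; rewrite /GRing.scale/=; ring.
have DV := @is_deriveV _ (fun w : R => 1 + w ^+ 2) w _ _ w0 DQ.
apply: is_derive_eq; rewrite /mehler2 /= /GRing.scale/=.
have -> : cos (2 * tau * asinh w) = mehler tau w * hypot1 w.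
  by rewrite /mehler divfK.
rewrite /mehler1 /=; field.
by rewrite h0 w0.
Qed.

Lemma normr_cos (a : R) : `|cos a| <= 1.
Proof. by rewrite ler_norml cos_geN1 cos_le1. Qed.

Lemma normr_mehler tau w : `|mehler tau w| <= 1.
Proof.
rewrite /mehler normrM normfV (gtr0_norm (hypot1_gt0 w)) ler_pdivrMr ?hypot1_gt0//.
by rewrite mul1r; apply: le_trans (hypot1_ge1 w); exact: normr_cos.
Qed.

Lemma normr_mehler1 tau w : `|mehler1 tau w| <= 2 * `|tau| + 1.
Proof.
rewrite /mehler1 normrM normrN normfV (gtr0_norm (hypot1_arg_gt0 w)).
rewrite ler_pdivrMr ?hypot1_arg_gt0//.
apply: (le_trans (ler_normD _ _)).
rewrite (normrM w) (normrM (2 * tau)) (normrM 2) normr_nat.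
have := normr_mehler tau w; have := sin_max (2 * tau * asinh w).
have t0 := normr_ge0 tau; have w0 := normr_ge0 w.
rewrite -(real_normK (num_real w)) => h1 h2.
have := ler_wpM2l t0 h1; have := ler_wpM2l w0 h2; have := sqr_ge0 (`|w| - 1).
have := mulr_ge0 t0 (sqr_ge0 `|w|); lra.
Qed.

Lemma mehler1_0 tau : mehler1 tau 0 = 0.
Proof. by rewrite /mehler1 asinh0 mulr0 sin0 !(mulr0, mul0r, addr0) oppr0 mul0r. Qed.

Lemma normr_mehler2 tau w :
  `|mehler2 tau w| <= 3 * (2 * `|tau| + 1) + (1 + 4 * tau ^+ 2).
Proof.
rewrite /mehler2 normrM normrN normfV (gtr0_norm (hypot1_arg_gt0 w)).
rewrite ler_pdivrMr ?hypot1_arg_gt0//.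
have q : 0 <= 1 + 4 * tau ^+ 2 by rewrite addr_ge0// mulr_ge0// sqr_ge0.
apply: (le_trans (ler_normD _ _)).
rewrite (normrM (3 * w)) (normrM 3) (normrM (1 + _)) normr_nat (ger0_norm q).
have := normr_mehler tau w; have := normr_mehler1 tau w.
have t0 := normr_ge0 tau; have w0 := normr_ge0 w.
rewrite -(real_normK (num_real w)) => h1 h2.
have := ler_wpM2l q h2; have := ler_wpM2l w0 h1.
have w2 : `|w| <= 1 + `|w| ^+ 2 by have := sqr_ge0 (`|w| - 1); nra.
have := ler_wpM2r (_ : 0 <= 2 * `|tau| + 1) w2; rewrite addr_ge0 ?mulr_ge0// => /(_ isT).
have := mulr_ge0 q (sqr_ge0 `|w|); lra.
Qed.

End Mehler.

(** * Integrability of real functions *)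
Section RealIntegrable.
Context {R : realType}.
Notation mu := (@lebesgue_measure R).
Implicit Types (f g : R -> R) (D : set R).

Lemma le_integrableR D f g : measurable D -> measurable_fun D f ->
  (forall x, D x -> `|f x| <= g x) ->
  mu.-integrable D (EFin \o g) -> mu.-integrable D (EFin \o f).
Proof.
move=> mD mf fg.
apply: (@le_integrable _ _ R mu D mD (EFin \o f) (EFin \o g)).
- exact/measurable_EFinP.
- by move=> x Dx /=; rewrite lee_fin; apply: le_trans (fg x Dx) (ler_norm _).
Qed.

Lemma integrableRZl D k f : measurable D -> mu.-integrable D (EFin \o f) ->
  mu.-integrable D (EFin \o (fun x => k * f x)).
Proof.
move=> mD If; have := @integrableZl _ _ R mu D mD k _ If.
by apply: (@eq_integrable _ _ R mu D mD) => x _.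
Qed.

Lemma integrableRD D f g : measurable D -> mu.-integrable D (EFin \o f) ->
  mu.-integrable D (EFin \o g) -> mu.-integrable D (EFin \o (fun x => f x + g x)).
Proof.
move=> mD If Ig; have := @integrableD _ _ R mu D mD _ _ If Ig.
by apply: (@eq_integrable _ _ R mu D mD) => x _.
Qed.

Lemma integrableRB D f g : measurable D -> mu.-integrable D (EFin \o f) ->
  mu.-integrable D (EFin \o g) -> mu.-integrable D (EFin \o (fun x => f x - g x)).
Proof.
move=> mD If Ig; have := @integrableB _ _ R mu D mD _ _ If Ig.
by apply: (@eq_integrable _ _ R mu D mD) => x _.
Qed.

Lemma integrableR_norm D f : measurable D -> mu.-integrable D (EFin \o f) ->
  mu.-integrable D (EFin \o (fun x => `|f x|)).
Proof.
move=> mD If; have := integrable_abse If.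
by apply: (@eq_integrable _ _ R mu D mD) => x _.
Qed.

End RealIntegrable.

(** * Averages against the Cauchy density *)
Section CauchyAverage.
Context {R : realType}.
Notation mu := (@lebesgue_measure R).
Implicit Types (f F : R -> R) (m s x A B : R).
Let D : set R := `[0%R, +oo[.

(** This is [sin (atan m)]: with [m = tan theta] and [dm / (1 + m ^ 2) = dtheta], the
    half-line stands for the angles between 0 and [pi / 2]. *)
Definition sinatan m : R := m / hypot1 m.

Lemma measurable_halfline : R.-ocitv.-measurable.-sigma.-measurable D.
Proof. exact: measurable_itv. Qed.

Lemma measurable_oneDsqrV : measurable_fun [set: R] (fun m => (oneDsqr m)^-1 : R).
Proof. by apply: continuous_measurable_fun; exact: continuous_oneDsqrV. Qed.

Lemma integrable_oneDsqrV : mu.-integrable D (EFin \o (fun m => (oneDsqr m)^-1)).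
Proof.
apply/integrableP; split.
  by apply/measurable_EFinP; apply: measurable_funTS; exact: measurable_oneDsqrV.
under eq_integral => m _ do rewrite /= ger0_norm ?invr_ge0//.
by rewrite integral0y_oneDsqr ltry.
Qed.

Lemma Rintegral_oneDsqrV : \int[mu]_(m in D) (oneDsqr m)^-1 = pi / 2.
Proof. by rewrite /Rintegral integral0y_oneDsqr. Qed.

Lemma integrable_bounded_oneDsqrV f A : measurable_fun [set: R] f ->
  (forall m, `|f m| <= A) ->
  mu.-integrable D (EFin \o (fun m => f m * (oneDsqr m)^-1)).
Proof.
move=> mf fA.
apply: (@le_integrableR _ _ _ (fun m => A * (oneDsqr m)^-1) measurable_halfline).
- apply: measurable_funTS.
  by apply: measurable_funM => //; exact: measurable_oneDsqrV.
- by move=> m _; rewrite normrM [`|_^-1|]ger0_norm ?invr_ge0// ler_wpM2r.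
- exact: integrableRZl measurable_halfline integrable_oneDsqrV.
Qed.

Lemma normr_sinatan m : `|sinatan m| <= 1.
Proof.
rewrite /sinatan normrM normfV (gtr0_norm (hypot1_gt0 m)) ler_pdivrMr ?hypot1_gt0//.
by rewrite mul1r ltW// normr_lt_hypot1.
Qed.

Lemma is_derive_sinatan m : is_derive m 1 sinatan ((hypot1 m)^-1 * (oneDsqr m)^-1).
Proof.
have D1 := is_derive_hypot1 m; have h0 := hypot1_neq0 m.
have DV := is_deriveV h0 D1.
apply: is_derive_eq; rewrite /oneDsqr -sqr_hypot1 /GRing.scale/=.
have -> : (hypot1 m)^-1 / hypot1 m ^+ 2 = (hypot1 m ^+ 2 - m ^+ 2) / hypot1 m ^+ 3.
  by rewrite {2}sqr_hypot1; field.
by field.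
Qed.

Lemma continuous_sinatan : continuous sinatan.
Proof. by move=> m; exact: is_derive_continuous (is_derive_sinatan m). Qed.

(** The fundamental theorem on a half-line wants a nonnegative integrand; adding a
    multiple of the density [1 / (1 + m ^ 2)], whose primitive is [atan], makes any
    dominated integrand nonnegative. *)
Lemma Rintegral_FTC_oneDsqr f F A (l : R) : continuous f ->
  (forall m, `|f m| <= A * (oneDsqr m)^-1) ->
  (forall m, is_derive m 1 F (f m)) -> F m @[m --> +oo] --> l ->
  \int[mu]_(m in D) f m = l - F 0.
Proof.
move=> cf fA dF Fl.
have mf : measurable_fun [set: R] f by exact: continuous_measurable_fun.
pose g m := f m + A * (oneDsqr m)^-1; pose G m := F m + A * atan m.
have dG m : is_derive m 1 G (g m).
  have dFm := dF m; apply: is_derive_eq.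
  by rewrite /g /oneDsqr /GRing.scale/=; ring.
have G0 : G 0 = F 0 by rewrite /G atan0 mulr0 addr0.
have cF0 := is_derive_continuous (dG 0).
have I : \int[mu]_(m in D) g m = (l + A * (pi / 2)) - G 0.
  apply: Rintegral_ge0_continuous_FTC2y.
  - move=> m _; have := fA m; rewrite ler_norml => /andP[h _].
    by rewrite /g -lerBlDr sub0r.
  - apply: continuous_subspaceT => m; apply: cvgD; first exact: cf.
    by apply: cvgM; [exact: cvg_cst|exact: continuous_oneDsqrV].
  - by apply: cvgD => //; apply: cvgM; [exact: cvg_cst|exact: cvgy_atan].
  - by move=> m _; case: (dG m).
  - exact: cvg_at_right_filter.
  - by move=> m _; rewrite derive1E; case: (dG m).
have int1 : mu.-integrable D (EFin \o f).
  apply: (@le_integrableR _ _ _ (fun m => A * (oneDsqr m)^-1) measurable_halfline) => //.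
  - exact: measurable_funTS.
  - exact: integrableRZl measurable_halfline integrable_oneDsqrV.
have int2 : mu.-integrable D (EFin \o (fun m => A * (oneDsqr m)^-1)).
  exact: integrableRZl measurable_halfline integrable_oneDsqrV.
move: I; rewrite RintegralD//; [|exact: measurable_halfline].
rewrite RintegralZl//; [|exact: measurable_halfline|exact: integrable_oneDsqrV].
by rewrite Rintegral_oneDsqrV G0 => h; lra.
Qed.

(** The integral of [sin theta ^ k * f (s * sin theta)] over the angles [theta] between
    0 and [pi / 2]. *)
Definition avg k f s : R :=
  \int[mu]_(m in D) (sinatan m ^+ k * f (s * sinatan m) * (oneDsqr m)^-1).

Lemma continuous_avg_integrand k f s : continuous f ->
  continuous (fun m => sinatan m ^+ k * f (s * sinatan m)).
Proof.
move=> cf m; apply: cvgM.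
  apply: (@continuous_comp _ _ _ sinatan (fun x : R => x ^+ k)).
    exact: continuous_sinatan.
  exact: exprn_continuous.
apply: (@continuous_comp _ _ _ (fun m => s * sinatan m) f); last exact: cf.
by apply: cvgM; [exact: cvg_cst|exact: continuous_sinatan].
Qed.

Lemma normr_avg_integrand k f A s m : (forall w, `|f w| <= A) ->
  `|sinatan m ^+ k * f (s * sinatan m)| <= A.
Proof.
move=> fA; rewrite normrM normrX -[leRHS]mul1r; apply: ler_pM => //.
by rewrite exprn_ile1// normr_sinatan.
Qed.

Lemma integrable_avg k f A s : continuous f -> (forall w, `|f w| <= A) ->
  mu.-integrable D (EFin \o (fun m => sinatan m ^+ k * f (s * sinatan m) * (oneDsqr m)^-1)).
Proof.
move=> cf fA; apply: (@integrable_bounded_oneDsqrV _ A).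
  by apply: continuous_measurable_fun; exact: continuous_avg_integrand.
by move=> m; exact: normr_avg_integrand.
Qed.

(** Differentiation under the integral sign; each derivative brings out one more factor
    [sinatan m], which is why the power [k] is part of [avg]. *)
Lemma is_derive_avg k f (df : R -> R) A B s :
  (forall w : R, is_derive w 1 f (df w)) ->
  (forall w, `|f w| <= A) -> (forall w, `|df w| <= B) ->
  is_derive s 1 (avg k f) (avg k.+1 df s).
Proof.
move=> dfP fA dfB.
have cf : continuous f by move=> w; exact: is_derive_continuous (dfP w).
pose g x m := sinatan m ^+ k * f (x * sinatan m) * (oneDsqr m)^-1.
have dg x m : is_derive x 1 (g ^~ m)
    (sinatan m ^+ k.+1 * df (x * sinatan m) * (oneDsqr m)^-1).
  have D1 : is_derive x 1 (fun x => x * sinatan m) (sinatan m).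
    by apply: is_derive_eq; rewrite /GRing.scale/=; ring.
  have DC := @is_derive1_comp _ f (fun x : R => x * sinatan m) x _ _ (dfP _) D1.
  rewrite (_ : g ^~ m = (sinatan m ^+ k * (oneDsqr m)^-1) *: (f \o *%R^~ (sinatan m))).
    by apply: is_derive_eq; rewrite /GRing.scale/= exprS; ring.
  by apply/funext => y; rewrite /g fctE /GRing.scale/= mulrAC.
have dgE x m : partial1of2 g x m = sinatan m ^+ k.+1 * df (x * sinatan m) * (oneDsqr m)^-1.
  by rewrite partial1of2E; case: (dg x m).
have Is : `]s - 1, s + 1[%classic s by rewrite /= in_itv/=; apply/andP; split; lra.
have B0 : 0 <= B by apply: le_trans (dfB 0).
have intg x : `](s - 1)%R, (s + 1)%R[%classic x -> mu.-integrable D (EFin \o g x).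
  by move=> _; exact: integrable_avg cf fA.
have derg x m : `](s - 1)%R, (s + 1)%R[%classic x -> D m -> derivable (g ^~ m) x 1.
  by move=> _ _; case: (dg x m).
have G0 m : 0 <= B * (oneDsqr m)^-1 by rewrite mulr_ge0.
have intG : mu.-integrable D (EFin \o (fun m => B * (oneDsqr m)^-1)).
  exact: integrableRZl measurable_halfline integrable_oneDsqrV.
have ub x m : `](s - 1)%R, (s + 1)%R[%classic x -> D m ->
    `|partial1of2 g x m| <= B * (oneDsqr m)^-1.
  move=> _ _; rewrite dgE normrM [`|_^-1|]ger0_norm// ler_wpM2r//.
  exact: normr_avg_integrand.
have H1 := derivable_under_integral measurable_halfline Is intg derg G0 intG ub.
have H2 := differentiation_under_integral measurable_halfline Is intg derg G0 intG ub.
apply: DeriveDef; first exact: H1.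
by rewrite -derive1E [LHS]H2; apply: eq_Rintegral => m _; exact: dgE.
Qed.

Lemma normr_avg k f A s : continuous f -> (forall w, `|f w| <= A) ->
  `|avg k f s| <= A * (pi / 2).
Proof.
move=> cf fA; have I := integrable_avg k s cf fA.
apply: (le_trans (le_normr_Rintegral measurable_halfline I)).
rewrite -Rintegral_oneDsqrV -RintegralZl//; last 2 first.
- exact: measurable_halfline.
- exact: integrable_oneDsqrV.
apply: le_Rintegral.
- exact: measurable_halfline.
- exact: integrableR_norm measurable_halfline I.
- have := integrableZl measurable_halfline A integrable_oneDsqrV.
  by apply: eq_integrable => //; exact: measurable_halfline.
- move=> m _; rewrite normrM [`|_^-1|]ger0_norm// ler_wpM2r//.
  exact: normr_avg_integrand.
Qed.

End CauchyAverage.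

(** * Conical functions *)
Section Conical.
Context {R : realType}.
Notation mu := (@lebesgue_measure R).
Implicit Types (tau w s m x : R).

Lemma continuous_mehler tau : continuous (mehler tau).
Proof. by move=> w; exact: is_derive_continuous (is_derive_mehler tau w). Qed.

Lemma continuous_mehler1 tau : continuous (mehler1 tau).
Proof. by move=> w; exact: is_derive_continuous (is_derive_mehler1 tau w). Qed.

Lemma continuous_mehler2 tau : continuous (mehler2 tau).
Proof.
have ci : continuous (fun w : R => (1 + w ^+ 2)^-1) by exact: continuous_oneDsqrV.
move=> w; apply: cvgM; last exact: ci.
apply: cvgN; apply: cvgD; apply: cvgM.
- by apply: cvgM; [exact: cvg_cst|exact: cvg_id].
- exact: continuous_mehler1.
- exact: cvg_cst.
- exact: continuous_mehler.
Qed.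

Lemma cvg_hypot1V : (hypot1 m)^-1 @[m --> +oo] --> (0 : R).
Proof.
apply/(@gtr0_cvgV0 R R _ _ (@hypot1 R)).
  by apply: nearW => m; exact: hypot1_gt0.
apply: (@ger_cvgy _ _ _ _ id); last exact: cvg_id.
by apply: nearW => m; rewrite (le_trans (ler_norm _))// ltW// normr_lt_hypot1.
Qed.

(** The integral of Mehler and Dirichlet for the Legendre function of degree
    [-1/2 + i tau] at [1 + 2 s ^ 2], that is, for the Gauss function of parameters
    [1/2 - i tau], [1/2 + i tau], 1 at [- s ^ 2]. It is defined for every real [s], beyond
    the disc of convergence of the Gauss series, and its bound by 1 is immediate. *)
Definition conical tau s : R := 2 / pi * avg 0 (mehler tau) s.
Definition conical1 tau s : R := 2 / pi * avg 1 (mehler1 tau) s.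
Definition conical2 tau s : R := 2 / pi * avg 2 (mehler2 tau) s.

Lemma is_derive_conical tau s : is_derive s 1 (conical tau) (conical1 tau s).
Proof.
have D := is_derive_avg 0 s (is_derive_mehler tau) (normr_mehler tau)
  (normr_mehler1 tau).
by rewrite /conical1 -[_ * _]/(_ *: _); apply: is_deriveZ.
Qed.

Lemma is_derive_conical1 tau s : is_derive s 1 (conical1 tau) (conical2 tau s).
Proof.
have D := is_derive_avg 1 s (is_derive_mehler1 tau) (normr_mehler1 tau)
  (normr_mehler2 tau).
by rewrite /conical2 -[_ * _]/(_ *: _); apply: is_deriveZ.
Qed.

Lemma normr_conical tau s : `|conical tau s| <= 1.
Proof.
rewrite /conical normrM gtr0_norm ?divr_gt0 ?pi_gt0//.
have := normr_avg 0 s (@continuous_mehler tau) (normr_mehler tau).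
rewrite mul1r => h.
have p0 : 0 < 2 / pi :> R by rewrite divr_gt0// pi_gt0.
have := ler_wpM2l (ltW p0) h; rewrite mulrA divfK ?gt_eqF ?pi_gt0// divff//.
Qed.

Lemma conical_at0 tau : conical tau 0 = 1.
Proof.
rewrite /conical /avg.
under eq_Rintegral do rewrite expr0 mul1r mul0r {1}/mehler asinh0 mulr0 cos0
  /hypot1 expr0n addr0 sqrtr1 divr1 mul1r.
by rewrite Rintegral_oneDsqrV mulrA divfK ?gt_eqF ?pi_gt0// divff.
Qed.

Lemma conical1_at0 tau : conical1 tau 0 = 0.
Proof.
rewrite /conical1 /avg.
under eq_Rintegral do rewrite mul0r mehler1_0 mulr0 mul0r.
by rewrite /Rintegral integral_cst//= ?mul0e ?mulr0//; exact: measurable_halfline.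
Qed.

(** Eliminating [mehler] by means of its own equation leaves an integrand that is the
    derivative in [m] of [- mehler1 tau (s * sinatan m) / hypot1 m], a function that
    vanishes at both ends of the half-line. *)
Lemma conical_ode tau s :
  s * (1 + s ^+ 2) * conical2 tau s + (1 + 3 * s ^+ 2) * conical1 tau s
  + (1 + 4 * tau ^+ 2) * s * conical tau s = 0.
Proof.
set a := s * (1 + s ^+ 2); set b := 1 + 3 * s ^+ 2; set c := (1 + 4 * tau ^+ 2) * s.
suff : a * avg 2 (mehler2 tau) s + b * avg 1 (mehler1 tau) s + c * avg 0 (mehler tau) s = 0.
  move=> E; rewrite /conical /conical1 /conical2 -[RHS](mulr0 (2 / pi)) -E.
  by ring.
have I0 := integrable_avg 0 s (@continuous_mehler tau) (normr_mehler tau).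
have I1 := integrable_avg 1 s (@continuous_mehler1 tau) (normr_mehler1 tau).
have I2 := integrable_avg 2 s (@continuous_mehler2 tau) (normr_mehler2 tau).
have mD := @measurable_halfline R.
rewrite /avg -!RintegralZl//; try exact: mD.
have J2 := integrableRZl a mD I2; have J1 := integrableRZl b mD I1.
have J0 := integrableRZl c mD I0; have J21 := integrableRD mD J2 J1.
rewrite -(RintegralD mD J2 J1) -(RintegralD mD J21 J0).
pose q m := (oneDsqr m)^-1.
pose f m := (sinatan m * mehler1 tau (s * sinatan m) - s * q m * mehler2 tau (s * sinatan m)) * q m.
pose F m := - ((hypot1 m)^-1 * mehler1 tau (s * sinatan m)).
have qE m : q m = 1 - sinatan m ^+ 2.
  rewrite /q /oneDsqr -sqr_hypot1 /sinatan expr_div_n.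
  have -> : 1 - m ^+ 2 / hypot1 m ^+ 2 = (hypot1 m ^+ 2 - m ^+ 2) / hypot1 m ^+ 2.
    by field; exact: hypot1_neq0.
  by rewrite {2}sqr_hypot1; field; exact: hypot1_neq0.
transitivity (\int[mu]_(m in `[0%R, +oo[) f m).
  apply: eq_Rintegral => m _; rewrite /f -/(q m) expr0 expr1.
  have : (1 + (s * sinatan m) ^+ 2) * mehler2 tau (s * sinatan m) =
      - (3 * (s * sinatan m) * mehler1 tau (s * sinatan m)
         + (1 + 4 * tau ^+ 2) * mehler tau (s * sinatan m)).
    by rewrite /mehler2 mulrC divfK// gt_eqF// hypot1_arg_gt0.
  set M0 := mehler _ _; set M1 := mehler1 _ _; set M2 := mehler2 _ _ => E.
  have -> : c * (1 * M0 * q m) = s * q m * ((1 + 4 * tau ^+ 2) * M0).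
    by rewrite /c; ring.
  have -> : (1 + 4 * tau ^+ 2) * M0 =
      - ((1 + (s * sinatan m) ^+ 2) * M2) - 3 * (s * sinatan m) * M1 by rewrite E; ring.
  rewrite [in RHS]mulrBl [X in _ = _ - s * X * _ * _]qE /a /b; ring.
have dF m : is_derive m 1 F (f m).
  have D1 : is_derive m 1 (fun m => s * sinatan m) (s * ((hypot1 m)^-1 * q m)).
    have D := is_derive_sinatan m.
    by apply: is_derive_eq; rewrite /GRing.scale/= -/(q m); ring.
  have D2 := @is_derive1_comp _ (mehler1 tau) (fun m => s * sinatan m) m _ _
    (is_derive_mehler1 tau (s * sinatan m)) D1.
  have D3 := is_deriveV (hypot1_neq0 m) (is_derive_hypot1 m).
  apply: is_derive_eq; rewrite /GRing.scale/= /f.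
  rewrite /q /oneDsqr -sqr_hypot1 /sinatan; field; exact: hypot1_neq0.
pose A := 2 * `|tau| + 1 + `|s| * (3 * (2 * `|tau| + 1) + (1 + 4 * tau ^+ 2)).
have q01 m : 0 <= q m <= 1.
  by rewrite invr_ge0 (le_trans _ (oneDsqr_ge1 m))//=; exact: oneDsqrV_le1.
rewrite (@Rintegral_FTC_oneDsqr _ f F A 0).
- by rewrite /F /sinatan mul0r mulr0 mehler1_0 mulr0 oppr0 subr0.
- move=> m; apply: cvgM; last exact: continuous_oneDsqrV.
  have cw : {for m, continuous (fun m => s * sinatan m)}.
    by apply: cvgM; [exact: cvg_cst|exact: continuous_sinatan].
  apply: cvgB; apply: cvgM.
  + exact: continuous_sinatan.
  + apply: (@continuous_comp _ _ _ (fun m => s * sinatan m) (mehler1 tau)) => //.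
    exact: continuous_mehler1.
  + by apply: cvgM; [exact: cvg_cst|exact: continuous_oneDsqrV].
  + apply: (@continuous_comp _ _ _ (fun m => s * sinatan m) (mehler2 tau)) => //.
    exact: continuous_mehler2.
- move=> m; have /andP[q0 q1] := q01 m.
  rewrite /f normrM (ger0_norm q0) ler_wpM2r//.
  apply: (le_trans (ler_normB _ _)); rewrite (normrM (sinatan m)) (normrM (s * q m)).
  rewrite (normrM s) (ger0_norm q0); apply: lerD.
    by rewrite -[leRHS]mul1r; apply: ler_pM => //; [exact: normr_sinatan|exact: normr_mehler1].
  apply: ler_pM => //; [by rewrite mulr_ge0| |exact: normr_mehler2].
  by rewrite -[leRHS]mulr1 ler_wpM2l.
- have H : (2 * `|tau| + 1) * (hypot1 m)^-1 @[m --> +oo] --> (0 : R).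
    by rewrite -[X in _ --> X](mulr0 (2 * `|tau| + 1)); apply: cvgM;
      [exact: cvg_cst|exact: cvg_hypot1V].
  apply: (squeeze_cvgr (f := fun m => - ((2 * `|tau| + 1) * (hypot1 m)^-1)) _ _ H).
    2: by rewrite -oppr0; exact: cvgN H.
  apply: nearW => m; rewrite -ler_norml /F normrN normrM mulrC.
  rewrite (ger0_norm (_ : 0 <= (hypot1 m)^-1)) ?invr_ge0 ?(ltW (hypot1_gt0 _))//.
  by rewrite ler_wpM2r ?invr_ge0 ?(ltW (hypot1_gt0 _))// normr_mehler1.
Qed.

End Conical.

(** * Analytic continuation of the Gauss series *)
Section Continuation.
Context {R : realType}.
Implicit Types (tau s z x : R).

Lemma analytic_at_eq (f g : R -> R) (z0 e : R) : 0 < e ->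
  (forall z, `|z - z0| < e -> f z = g z) -> analytic_at f z0 -> analytic_at g z0.
Proof.
move=> e0 fg [c [r [r0 cf]]]; exists c, (Num.min e r).
rewrite lt_min e0 r0; split=> // z; rewrite lt_min => /andP[ze zr].
by rewrite -fg//; exact: cf.
Qed.

(** The general uniqueness result does not apply at the singular point 0. There, the
    energy [(1 + s ^ 2) * u1 ^ 2 + La * u ^ 2] decreases to the right of 0, where it vanishes. *)
Lemma singular_ode_unique (u u1 u2 : R -> R) (La b : R) : 0 < La ->
  (forall s, 0 <= s < b -> is_derive s 1 u (u1 s)) ->
  (forall s, 0 <= s < b -> is_derive s 1 u1 (u2 s)) ->
  (forall s, 0 <= s < b ->
     s * (1 + s ^+ 2) * u2 s + (1 + 3 * s ^+ 2) * u1 s + La * s * u s = 0) ->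
  u 0 = 0 -> u1 0 = 0 -> forall s, 0 <= s < b -> u s = 0.
Proof.
move=> La0 du du1 ode u00 u10 s /andP[s0 sb].
pose E x := (1 + x ^+ 2) * u1 x ^+ 2 + La * u x ^+ 2.
pose dE x := 2 * x * u1 x ^+ 2 + 2 * (1 + x ^+ 2) * u1 x * u2 x + 2 * La * u x * u1 x.
have : E s <= E 0.
  apply: (@is_derive_nincr _ E dE 0 s s0) => x /andP[x0 xs].
    have xb : 0 <= x < b by rewrite x0 (le_lt_trans xs).
    have D1 := du _ xb; have D2 := du1 _ xb.
    by apply: is_derive_eq; rewrite /GRing.scale/= /dE; ring.
  have xb : 0 <= x < b by rewrite x0 (le_lt_trans xs).
  move: x0; rewrite le_eqVlt => /predU1P[<-|x0].
    by rewrite /dE u10 !(mulr0, mul0r, expr0n)/= !addr0.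
  rewrite -(pmulr_rle0 _ x0).
  have -> : x * dE x = 2 * x ^+ 2 * u1 x ^+ 2 + 2 * u1 x *
      ((x * (1 + x ^+ 2) * u2 x + (1 + 3 * x ^+ 2) * u1 x + La * x * u x)
        - (1 + 3 * x ^+ 2) * u1 x) by rewrite /dE; ring.
  rewrite ode//.
  have := mulr_ge0 (sqr_ge0 x) (sqr_ge0 (u1 x)); have := sqr_ge0 (u1 x).
  lra.
rewrite {2}/E u00 u10 !expr0n/= !mulr0 addr0 => Es.
have : La * u s ^+ 2 <= 0.
  apply: le_trans Es; rewrite /E lerDr mulr_ge0 ?sqr_ge0//.
  by rewrite addr_ge0// sqr_ge0.
rewrite pmulr_rle0// => us; apply/eqP; rewrite -sqrf_eq0.
by rewrite eq_le us sqr_ge0.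
Qed.

Definition gauss0 tau z := psum (conical_coef tau) z.
Definition gauss1 tau z := psum (pseries_diffs (conical_coef tau)) z.
Definition gauss2 tau z := psum (pseries_diffs (pseries_diffs (conical_coef tau))) z.

Lemma is_derive_gauss0 tau z : `|z| < 1 -> is_derive z 1 (gauss0 tau) (gauss1 tau z).
Proof. by move=> z1; exact: is_derive_psum (conical_coef_bound tau) z1. Qed.

Lemma is_derive_gauss1 tau z : `|z| < 1 -> is_derive z 1 (gauss1 tau) (gauss2 tau z).
Proof.
move=> z1; apply: (@is_derive_psum _ _ ((`|z| + 1) / 2)); last by lra.
apply: coef_bound_diffs (conical_coef_bound tau).
by have z0 := normr_ge0 z; apply/andP; split; lra.
Qed.

Lemma gauss_ode tau z : `|z| < 1 ->
  hyp_ode (4^-1 + tau ^+ 2) z (gauss0 tau z) (gauss1 tau z) (gauss2 tau z).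
Proof.
move=> z1; have := psum_ode (conical_coef_rec tau) (conical_coef_bound tau) z1.
by rewrite add0r.
Qed.

(** Both sides solve the equation of the conical functions with the same
    data at the singular point 0. *)
Lemma conical_gauss tau s : 0 <= s < 1 -> conical tau s = gauss0 tau (- s ^+ 2).
Proof.
move=> s01; apply/esym/eqP; rewrite -subr_eq0; apply/eqP.
pose Z (x : R) := - x ^+ 2.
have Z1 x : 0 <= x < 1 -> `|Z x| < 1.
  by move=> /andP[x0 x1]; rewrite normrN normrX ger0_norm// exprn_ilt1.
have dZ x : is_derive x 1 Z (- 2 * x).
  by apply: is_derive_eq; rewrite /GRing.scale/=; ring.
pose y1 x := - 2 * x * gauss1 tau (Z x).
pose y2 x := 4 * x ^+ 2 * gauss2 tau (Z x) - 2 * gauss1 tau (Z x).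
have D1 x : 0 <= x < 1 -> is_derive x 1 (gauss0 tau \o Z) (y1 x).
  move=> x01; have := @is_derive1_comp _ (gauss0 tau) Z x _ _
    (is_derive_gauss0 tau (Z1 _ x01)) (dZ x).
  by rewrite mulrC.
have D2 x : 0 <= x < 1 -> is_derive x 1 y1 (y2 x).
  move=> x01; have D := @is_derive1_comp _ (gauss1 tau) Z x _ _
    (is_derive_gauss1 tau (Z1 _ x01)) (dZ x).
  by apply: is_derive_eq; rewrite /GRing.scale/= /y2; ring.
apply: (@singular_ode_unique (gauss0 tau \o Z - conical tau) (y1 - conical1 tau)
  (y2 - conical2 tau) (1 + 4 * tau ^+ 2) 1 _ _ _ _ _ _ _ s01)
  => [|x x01|x x01|x x01||].
- by rewrite ltr_wpDr// mulr_ge0// sqr_ge0.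
- have D := is_derive_conical tau x; have D' := D1 _ x01.
  exact: is_deriveB.
- have D := is_derive_conical1 tau x; have D' := D2 _ x01.
  exact: is_deriveB.
- have E1 := conical_ode tau x; have := gauss_ode tau (Z1 _ x01).
  rewrite /hyp_ode => E2; rewrite !fctE/=.
  apply: (@eq_trans _ _ (- 4 * x * 0 - 0)); last by ring.
  by rewrite -{1}E2 -E1 /y1 /y2 /Z; field.
- by rewrite !fctE/= /Z expr0n oppr0 /gauss0 psum0 conical_at0 /conical_coef
    big_ord0 fact0 expr1n divr1 subrr.
- by rewrite !fctE/= /y1 conical1_at0 mulr0 mul0r subrr.
Qed.

(** The two formulas agree on ]-1, 0] by [conical_gauss]; together they cover ]-oo, 1[. *)
Definition hypR tau z : R :=
  if z < 0 then conical tau (Num.sqrt (- z)) else gauss0 tau z.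

Lemma hypR_gauss tau z : `|z| < 1 -> hypR tau z = gauss0 tau z.
Proof.
move=> z1; rewrite /hypR; case: ifPn => // z0.
have mz0 : 0 <= - z by rewrite oppr_ge0 ltW.
have S1 : Num.sqrt (- z) < 1.
  have : Num.sqrt (- z) < Num.sqrt 1 by rewrite ltr_sqrt// -ltr0_norm.
  by rewrite sqrtr1.
by rewrite conical_gauss ?sqrtr_ge0// sqr_sqrtr// opprK.
Qed.

Lemma hypR_conical tau s : 0 <= s -> hypR tau (- s ^+ 2) = conical tau s.
Proof.
rewrite le_eqVlt => /predU1P[<-|s0].
  rewrite conical_gauss ?lexx ?ltr01// hypR_gauss//.
  by rewrite expr0n oppr0 normr0.
by rewrite /hypR oppr_lt0 exprn_gt0// opprK sqrtr_sqr gtr0_norm.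
Qed.

(** On the negative axis [s = sqrt (- z)] carries [conical_ode] to the hypergeometric
    equation, whose solutions are analytic at regular points; at the singular point 0 the
    Gauss series is itself the required expansion. *)
Lemma hypR_analytic tau (z0 : R) : z0 < 1 -> analytic_at (hypR tau) z0.
Proof.
move=> z01; have [z00|z00|->] := ltgtP z0 0.
- have e0 : 0 < - z0 by rewrite oppr_gt0.
  have neg z : `|z - z0| < - z0 -> z < 0.
    by rewrite ltr_norml => /andP[_]; lra.
  apply: (@analytic_at_eq (fun z => conical tau (Num.sqrt (- z))) _ _ _ e0).
    by move=> z /neg z0'; rewrite /hypR z0'.
  pose S (z : R) := Num.sqrt (- z).
  have S0 z : z < 0 -> 0 < S z by move=> z0'; rewrite sqrtr_gt0 oppr_gt0.
  have S2 z : z < 0 -> S z ^+ 2 = - z.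
    by move=> z0'; rewrite sqr_sqrtr// oppr_ge0 ltW.
  have dS z : z < 0 -> is_derive z 1 S (- (2 * S z)^-1).
    move=> z0'; have mz0 : 0 < - z by rewrite oppr_gt0.
    have D : is_derive z 1 (@GRing.opp R) (-1).
      by apply: is_derive_eq.
    have := @is_derive1_comp _ Num.sqrt (@GRing.opp R) z _ _ (is_derive1_sqrt mz0) D.
    by rewrite mulrN1.
  pose y1 z := - conical1 tau (S z) / (2 * S z).
  pose y2 z := (S z * conical2 tau (S z) - conical1 tau (S z)) / (4 * S z ^+ 3).
  apply: (@hyp_ode_analytic _ (4^-1 + tau ^+ 2) _ y1 y2 z0 _ _ z01 e0).
  + by rewrite lt_eqF.
  + move=> z /neg zn; have := @is_derive1_comp _ (conical tau) S z _ _
      (is_derive_conical tau (S z)) (dS _ zn).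
    by rewrite /y1 mulrN mulNr.
  + move=> z /neg zn; have D := @is_derive1_comp _ (conical1 tau) S z _ _
      (is_derive_conical1 tau (S z)) (dS _ zn).
    have DS := dS _ zn; have Sn : S z != 0 by rewrite gt_eqF// S0.
    have DV := @is_deriveV _ (fun z => 2 * S z) z (- (S z)^-1) 1.
    have {}DV := DV ltac:(by rewrite mulf_neq0) ltac:(by apply: is_derive_eq;
      rewrite /GRing.scale/=; field).
    apply: is_derive_eq; rewrite /GRing.scale/= /y2; field.
    exact: Sn.
  + move=> z /neg zn; have Sn : S z != 0 by rewrite gt_eqF// S0.
    have E := conical_ode tau (S z).
    have zE : z = - S z ^+ 2 by rewrite S2// opprK.
    rewrite /hyp_ode /y1 /y2 -/(S z); move: (S z) Sn E zE => s Sn E ->.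
    apply: (@eq_trans _ _ (- (4 * s)^-1 * 0)); last by rewrite mulr0.
    by rewrite -E; field.
- have e0 : 0 < Num.min z0 (1 - z0) by rewrite lt_min z00 subr_gt0.
  have nb z : `|z - z0| < Num.min z0 (1 - z0) -> `|z| < 1.
    rewrite lt_min !ltr_norml => /andP[/andP[h1 h2] /andP[h3 h4]].
    by apply/andP; split; lra.
  apply: (@analytic_at_eq (gauss0 tau) _ _ _ e0).
    by move=> z /nb z1; rewrite hypR_gauss.
  apply: (@hyp_ode_analytic _ (4^-1 + tau ^+ 2) _ (gauss1 tau) (gauss2 tau) z0 _ _ z01 e0).
  + by rewrite gt_eqF.
  + by move=> z /nb; exact: is_derive_gauss0.
  + by move=> z /nb; exact: is_derive_gauss1.
  + by move=> z /nb; exact: gauss_ode.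
- exists (conical_coef tau), 1; split=> // z; rewrite subr0 => z1.
  by rewrite hypR_gauss//; exact: cvg_pseries (conical_coef_bound tau) z1.
Qed.

(** Let [b] be the infimum of the points from which [f] vanishes up to [a]. The expansion
    of [f] at [b] vanishes to the right of [b], hence has zero coefficients, and [f] vanishes
    to the left of [b] as well. *)
Lemma analytic_continuation_unique (f : R -> R) (a : R) : 0 < a ->
  (forall z0, z0 < a -> analytic_at f z0) ->
  (forall z, `|z| < a -> f z = 0) -> forall z, z < a -> f z = 0.
Proof.
move=> a0 fa f0 z za; have [z0|z0] := leP 0 z.
  by apply: f0; rewrite ger0_norm.
pose A := [set b | z <= b <= 0 /\ forall t, b <= t < a -> f t = 0].
have A0 : A 0.
  split; first by rewrite (ltW z0) lexx.
  by move=> t /andP[t0 ta]; apply: f0; rewrite ger0_norm.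
have lbA : has_inf A.
  by split; [exists 0|exists z => b [/andP[zb _] _]].
pose b := inf A.
have zb : z <= b by apply: lb_le_inf; [exists 0|move=> c [/andP[]]].
have b0 : b <= 0 by apply: ge_inf => //; case: lbA.
have right t : b < t < a -> f t = 0.
  move=> /andP[bt ta]; have tb0 : 0 < t - b by rewrite subr_gt0.
  have [c [_ cf]] := inf_adherent tb0 lbA.
  by rewrite -/b addrC subrK => ct; apply: cf; rewrite (ltW ct).
have [c [r [r0 cf]]] := fa b (le_lt_trans b0 a0).
have c0 : forall n, c n = 0.
  have e0 : 0 < Num.min r a by rewrite lt_min r0.
  apply: (pseries_eq0 e0) => x; rewrite lt_min => /andP[x0 /andP[xr xa]].
  have := cf (b + x); rewrite addrC addKr => /(_ _)/cvg_trans; apply.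
    by rewrite gtr0_norm.
  by rewrite right//; apply/andP; split; lra.
have fb t : `|t - b| < r -> f t = 0.
  move=> /cf; rewrite (_ : pseries c _ = cst 0).
    by move=> h; apply: (cvg_unique (@norm_hausdorff _ _) h); exact: cvg_cst.
  by apply/funext => n; rewrite /pseries /series/= big1// => i _; rewrite c0 mul0r.
have [bz|bz] := eqVneq b z; first by apply: fb; rewrite bz subrr normr0.
pose b' := Num.max z (b - r / 2).
have b'b : b' < b by rewrite /b' gt_max lt_neqAle eq_sym bz zb/=; lra.
suff : A b' by move=> /ge_inf => /(_ lbA.2); rewrite -/b leNgt b'b.
split; first by rewrite /b' le_max lexx/= (le_trans (ltW b'b)).
move=> t /andP[b't ta]; have [tb|bt] := ltP t (b + r).
  apply: fb; rewrite ltr_norml; apply/andP; split; last by lra.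
  have : b - r / 2 <= b' by rewrite /b' le_max lexx orbT.
  lra.
by apply: right; apply/andP; split; lra.
Qed.

End Continuation.

(** * Iterated integrals of nonnegative functions *)
Section Tonelli.
Context {R : realType}.
Notation mu := (@lebesgue_measure R).
Notation TR := (measurableTypeR R).
Implicit Types (A B : set TR) (f g : TR * TR -> R).

Lemma integral_indicM A (h : R -> \bar R) : measurable A ->
  (\int[mu]_(x in A) h x = \int[mu]_x ((\1_A x)%:E * h x))%E.
Proof.
move=> mA; rewrite integral_mkcond; apply: eq_integral => x _.
by rewrite patchE indicE; case: ifP => _; rewrite ?mul1e ?mul0e.
Qed.

Lemma measurable_inner d (T : measurableType d) A (f : T * TR -> R) :
  measurable A -> measurable_fun [set: T * TR] f -> (forall z, 0 <= f z) ->
  measurable_fun [set: T] (fun x => \int[mu]_(y in A) (f (x, y))%:E)%E.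
Proof.
move=> mA mf f0.
pose F (z : T * TR) := ((\1_A z.2 : R) * f z)%:E.
have mF : measurable_fun [set: T * TR] F.
  apply/measurable_EFinP; apply: measurable_funM => //.
  exact: measurableT_comp (measurable_indic mA) measurable_snd.
have F0 z : (0 <= F z)%E by rewrite lee_fin mulr_ge0.
have := measurable_fun_fubini_tonelli_F (m2 := mu) F mF F0.
by apply: eq_measurable_fun => x _; rewrite /fubini_F [RHS]integral_indicM.
Qed.

Lemma tonelli A B f : measurable A -> measurable B ->
  measurable_fun [set: TR * TR] f -> (forall z, 0 <= f z) ->
  (\int[mu]_(x in A) \int[mu]_(y in B) (f (x, y))%:E =
   \int[mu]_(y in B) \int[mu]_(x in A) (f (x, y))%:E)%E.
Proof.
move=> mA mB mf f0.
pose F (z : TR * TR) := ((\1_A z.1 : R) * (\1_B z.2 : R) * f z)%:E.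
have mF : measurable_fun [set: TR * TR] F.
  apply/measurable_EFinP; apply: measurable_funM => //; apply: measurable_funM.
  - exact: measurableT_comp (measurable_indic mA) measurable_fst.
  - exact: measurableT_comp (measurable_indic mB) measurable_snd.
have F0 z : (0 <= F z)%E by rewrite lee_fin mulr_ge0// mulr_ge0.
have cst_out C (k : R) (h : R -> R) : measurable C -> (forall y, 0 <= h y) ->
    measurable_fun [set: TR] h -> 0 <= k ->
    (k%:E * \int[mu]_(y in C) (h y)%:E = \int[mu]_y ((k * (\1_C y) * h y)%:E))%E.
  move=> mC h0 mh k0; rewrite integral_indicM// -ge0_integralZl//=.
  - by apply: eq_integral => y _; rewrite !EFinM muleA.
  - by apply: emeasurable_funM; apply/measurable_EFinP.
  - by move=> y _; rewrite mule_ge0// lee_fin.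
have := fubini_tonelli (m1 := mu) (m2 := mu) F mF F0.
congr (_ = _); last first.
  rewrite [RHS]integral_indicM//; apply: eq_integral => y _.
  rewrite cst_out//; last exact: measurableT_comp mf (pair2_measurable y).
  by apply: eq_integral => x _; rewrite /F/= (mulrC (\1_B y)).
rewrite [RHS]integral_indicM//; apply: eq_integral => x _.
rewrite cst_out//; last exact: measurableT_comp mf (pair1_measurable x).
Qed.

End Tonelli.

(** * Changes of variable on lines and half-lines *)
Section Substitutions.
Context {R : realType}.
Notation mu := (@lebesgue_measure R).
Implicit Types (G T dT : R -> R) (x : R).

Lemma substitution_halfline G T dT (l : R) :
  (forall x, is_derive x 1 T (dT x)) -> continuous dT ->
  {in `[0, +oo[ &, {homo T : x y / x < y}} -> T 0 = 0 ->
  dT x @[x --> +oo] --> l -> T x @[x --> +oo] --> +oo ->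
  {within `[0, +oo[, continuous G} -> (forall x, 0 <= x -> 0 <= G x) ->
  (\int[mu]_(x in `[0%R, +oo[) (G x)%:E =
   \int[mu]_(x in `[0%R, +oo[) (G (T x) * dT x)%:E)%E.
Proof.
move=> TdT cdT incT T0 dTl Ty cG G0.
have DT : T^`()%classic = dT.
  by apply/funext => x; rewrite derive1E; case: (TdT x).
have := @increasing_ge0_integration_by_substitutiony R T G 0.
rewrite T0 DT; apply => //.
- by apply/cvg_ex; exists (dT 0); apply: cvg_at_right_filter; exact: cdT.
- by apply/cvg_ex; exists l.
- split; first by move=> x _; case: (TdT x).
  by apply: cvg_at_right_filter; exact: is_derive_continuous (TdT 0).
- by move=> x; rewrite in_itv/= andbT => /ltW; exact: G0.
Qed.

Lemma substitution_line G (a b : R) : 0 < a -> continuous G ->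
  (forall x, 0 <= G x) ->
  (\int[mu]_x (G x)%:E = \int[mu]_x (G (a * x + b) * a)%:E)%E.
Proof.
move=> a0 cG G0; pose T (x : R) := a * x + b.
have dT x : is_derive x 1 T a.
  by apply: is_derive_eq; rewrite /GRing.scale/=; ring.
have DT : T^`()%classic = cst a.
  by apply/funext => x; rewrite derive1E; case: (dT x).
have := @increasing_ge0_integration_by_substitutionT R T G.
rewrite DT; apply => //.
- by move=> x y xy; rewrite /T ltrD2r ltr_pM2l.
- by move=> x; exact: cvg_cst.
- exact: is_cvg_cst.
- exact: is_cvg_cst.
- apply/cvgrNyPle => A; near=> x; rewrite /T -lerBrDr mulrC -ler_pdivlMr//.
- apply/cvgryPge => A; near=> x; rewrite /T -lerBlDr mulrC -ler_pdivrMr//.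
Unshelve. all: by end_near. Qed.

End Substitutions.

(** * Continuity and measurability of elementary expressions *)
Section ContinuityCalculus.
Context {R : realType}.
Implicit Types (f g : R -> R).

Lemma continuous_cst (k : R) : continuous (fun _ : R => k).
Proof. by move=> x; exact: cvg_cst. Qed.

Lemma continuous_idR : continuous (fun x : R => x).
Proof. by move=> x; exact: cvg_id. Qed.

Lemma continuous_mulR f g : continuous f -> continuous g ->
  continuous (fun x => f x * g x).
Proof. by move=> cf cg x; apply: cvgM; [exact: cf|exact: cg]. Qed.

Lemma continuous_addR f g : continuous f -> continuous g ->
  continuous (fun x => f x + g x).
Proof. by move=> cf cg x; apply: cvgD; [exact: cf|exact: cg]. Qed.

Lemma continuous_oppR f : continuous f -> continuous (fun x => - f x).
Proof. by move=> cf x; apply: cvgN; exact: cf. Qed.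

Lemma continuous_compR g f : continuous g -> continuous f ->
  continuous (fun x => g (f x)).
Proof. by move=> cg cf x; apply: (@continuous_comp _ _ _ f g); [exact: cf|exact: cg]. Qed.

Lemma continuous_sqrR f : continuous f -> continuous (fun x => f x ^+ 2).
Proof. by move=> cf; under eq_fun do rewrite expr2; exact: continuous_mulR. Qed.

Lemma continuous_hypot1V : continuous (fun w : R => (hypot1 w)^-1).
Proof. by move=> x; apply: cvgV; [exact: hypot1_neq0|exact: continuous_hypot1]. Qed.

Lemma continuous_oneDsqrVR : continuous (fun w : R => (oneDsqr w)^-1).
Proof. exact: continuous_oneDsqrV. Qed.

Lemma measurable_compR d (T : measurableType d) g (f : T -> R) : continuous g ->
  measurable_fun [set: T] f -> measurable_fun [set: T] (fun z => g (f z)).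
Proof.
move=> cg mf; apply: (measurableT_comp (f := g)) => //.
exact: continuous_measurable_fun.
Qed.

Lemma measurable_sqrR d (T : measurableType d) (f : T -> R) :
  measurable_fun [set: T] f -> measurable_fun [set: T] (fun z => f z ^+ 2).
Proof. by move=> mf; under eq_fun do rewrite expr2; exact: measurable_funM. Qed.

Lemma measurable_oppR d (T : measurableType d) (f : T -> R) :
  measurable_fun [set: T] f -> measurable_fun [set: T] (fun z => - f z).
Proof. by move=> mf; exact: measurableT_comp. Qed.

End ContinuityCalculus.

Ltac continuous_head := first
  [ assumption | exact: continuous_expR | exact: continuous_cos
  | exact: sqrt_continuous | exact: continuous_coshR | exact: continuous_hypot1
  | exact: continuous_asinh | exact: continuous_sinatan ].

(** The syntax-directed rules that [continuity] and [measurability] follow are the closure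
    properties above; the integrands below are all built from them. *)
Ltac continuity := lazymatch goal with
  | |- forall x, @continuous_at _ _ x ?F =>
    lazymatch F with
    | (fun _ => ?k) => exact: continuous_cst
    | (fun w => w) => exact: continuous_idR
    | (fun w => @GRing.mul _ (@?f w) (@?g w)) =>
        apply: (@continuous_mulR _ f g); continuity
    | (fun w => @Algebra.add _ (@?f w) (@?g w)) =>
        apply: (@continuous_addR _ f g); continuity
    | (fun w => @Algebra.opp _ (@?f w)) =>
        apply: (@continuous_oppR _ f); continuity
    | (fun w => @GRing.exp _ (@?f w) _) =>
        apply: (@continuous_sqrR _ f); continuity
    | (fun w => @GRing.inv _ (@hypot1 _ (@?f w))) =>
        apply: (@continuous_compR _ _ f (@continuous_hypot1V _)); continuity
    | (fun w => @GRing.inv _ (@oneDsqr _ (@?f w))) =>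
        apply: (@continuous_compR _ _ f (@continuous_oneDsqrVR _)); continuity
    | (fun w => ?g (@?f w)) =>
        apply: (@continuous_compR _ g f); [continuous_head|continuity]
    end
  end.

Ltac measurability := lazymatch goal with
  | |- @measurable_fun _ _ ?T _ _ ?F =>
    lazymatch F with
    | (fun _ => ?k) => exact: measurable_cst
    | (fun w => w) => exact: measurable_id
    | (fun w => fst w) => exact: measurable_fst
    | (fun w => snd w) => exact: measurable_snd
    | (fun w => @GRing.mul _ (@?f w) (@?g w)) =>
        apply: (@measurable_funM _ T _ _ f g); measurability
    | (fun w => @Algebra.add _ (@?f w) (@?g w)) =>
        apply: (@measurable_funD _ T _ _ f g); measurability
    | (fun w => @Algebra.opp _ (@?f w)) =>
        apply: (@measurable_oppR _ _ T f); measurability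
    | (fun w => @GRing.exp _ (@?f w) _) =>
        apply: (@measurable_sqrR _ _ T f); measurability
    | (fun w => @GRing.inv _ (@hypot1 _ (@?f w))) =>
        apply: (@measurable_compR _ _ T _ f (@continuous_hypot1V _)); measurability
    | (fun w => @GRing.inv _ (@oneDsqr _ (@?f w))) =>
        apply: (@measurable_compR _ _ T _ f (@continuous_oneDsqrVR _)); measurability
    | (fun w => ?g (@?f w)) =>
        apply: (@measurable_compR _ _ T g f); [continuous_head|measurability]
    end
  end.

(** * Rotation and symmetry in the plane *)
Section Rotation.
Context {R : realType}.
Notation mu := (@lebesgue_measure R).
Notation TR := (measurableTypeR R).

(** The change of variables [u = p + q], [v = p - q] is made one variable at a time:
    [v = 2 p - u] at fixed [u], then [u = p + q] at fixed [p]. *)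
Lemma rotation (F : TR * TR -> R) : measurable_fun [set: TR * TR] F ->
  (forall z, 0 <= F z) -> (forall u : R, continuous (fun v : R => F (u, v))) ->
  (forall p : R, continuous (fun u : R => F (u, 2 * p - u))) ->
  (\int[mu]_u \int[mu]_v (F (u, v))%:E =
   \int[mu]_p \int[mu]_q (2 * F (p + q, p - q))%:E)%E.
Proof.
move=> mF F0 cF2 cF1.
transitivity (\int[mu]_u \int[mu]_p (F (u, (2 * p - u)%R) * 2)%:E)%E.
  by apply: eq_integral => u _; rewrite (@substitution_line _ _ 2 (- u)).
have mF' : measurable_fun [set: TR * TR] (fun z => F (z.1, 2 * z.2 - z.1) * 2).
  apply: measurable_funM => //.
  apply: (measurableT_comp mF); apply: measurable_fun_pair => //=.
  by measurability.
have := tonelli measurableT measurableT mF' _.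
move=> -> /=; last by move=> z; rewrite mulr_ge0.
apply: eq_integral => p _.
rewrite (@substitution_line _ (fun u => F (u, 2 * p - u) * 2) 1 p)//.
- apply: eq_integral => q _; congr (_%:E).
  rewrite mulr1 mul1r mulrC (addrC q) (_ : 2 * p - (p + q) = p - q)//; ring.
- apply: (@continuous_mulR _ (fun u => F (u, 2 * p - u)) (fun=> 2)).
    exact: cF1.
  exact: continuous_cst.
- by move=> u; rewrite mulr_ge0.
Qed.

Lemma integral_even (f : R -> R) : (forall x, 0 <= f x) -> continuous f ->
  (forall x, f (- x) = f x) ->
  (\int[mu]_x (f x)%:E = \int[mu]_(x in `[0%R, +oo[) (2 * f x)%:E)%E.
Proof.
move=> f0 cf ef; rewrite ge0_symfun_integralT//.
  rewrite -set_itvcy -ge0_integralZl//; last by move=> x _; rewrite lee_fin.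
  apply/measurable_EFinP; apply: measurable_funTS.
  exact: continuous_measurable_fun.
by move=> x /=; rewrite ef.
Qed.

Lemma quadrant (H : TR * TR -> R) : measurable_fun [set: TR * TR] H ->
  (forall z, 0 <= H z) -> (forall u : R, continuous (fun v : R => H (u, v))) ->
  (forall v : R, continuous (fun u : R => H (u, v))) ->
  (forall u v : R, H (u, - v) = H (u, v)) -> (forall u v : R, H (- u, v) = H (u, v)) ->
  (\int[mu]_p \int[mu]_q (H (p, q))%:E =
   \int[mu]_(q in `[0%R, +oo[) \int[mu]_(p in `[0%R, +oo[) (4 * H (p, q))%:E)%E.
Proof.
move=> mH H0 cH2 cH1 eH2 eH1.
transitivity (\int[mu]_p \int[mu]_(q in `[0%R, +oo[) (2 * H (p, q))%:E)%E.
  by apply: eq_integral => p _; rewrite (@integral_even (fun q => H (p, q))).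
have mH' : measurable_fun [set: TR * TR] (fun z => 2 * H z).
  exact: measurable_funM.
have mD : measurable (`[0%R, +oo[ : set TR) by exact: measurable_itv.
have := tonelli measurableT mD mH' _.
move=> -> /=; last by move=> z; rewrite mulr_ge0.
apply: eq_integral => q _.
rewrite (@integral_even (fun p => 2 * H (p, q)))//.
- by apply: eq_integral => p _; congr (_%:E); ring.
- by move=> p; rewrite mulr_ge0.
- apply: (@continuous_mulR _ (fun=> 2) (fun p => H (p, q))).
    exact: continuous_cst.
  exact: cH1.
- by move=> p; rewrite eH1.
Qed.

End Rotation.

(** * From hyperbolic angles to a Laplace integral *)
Section PolarCoordinates.
Context {R : realType}.
Notation mu := (@lebesgue_measure R).
Notation TR := (measurableTypeR R).
Implicit Types (x s m t w : R) (c : R -> R).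
Let D : set R := `[0%R, +oo[.

(** The density of the measure [c p dp] in the variable [X = sinh p]. *)
Definition profile c w : R := c (asinh w) * (hypot1 w)^-1.
(** The factor of the integrand that depends on [s = sqrt (X ^ 2 + Y ^ 2)] only, once the
    hyperbolic angles have been replaced by Cartesian coordinates. *)
Definition radial x s : R := expR (- (x * hypot1 s)) * (hypot1 s)^-1.
(** Chosen so that the argument [- t ^ 2 - 2 t] of the Olevskii kernel is
    [- shift_sqrt t ^ 2]. *)
Definition shift_sqrt t : R := Num.sqrt (t ^+ 2 + 2 * t).

Lemma homo_hypot1 : {in `[0, +oo[ &, {homo (@hypot1 R) : x y / x < y}}.
Proof.
move=> x y; rewrite !in_itv/= !andbT => x0 y0 xy.
by rewrite ltr_sqrt ?hypot1_arg_gt0// ltrD2l ltrXn2r.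
Qed.

Lemma homo_asinh : {in `[0, +oo[ &, {homo (@asinh R) : x y / x < y}}.
Proof.
move=> x y x0 y0 xy; rewrite ltr_ln ?posrE ?asinh_arg_gt0//.
by apply: ltrD => //; exact: homo_hypot1.
Qed.

Lemma cvgy_hypot1 : @hypot1 R w @[w --> +oo] --> +oo.
Proof.
apply: (@ger_cvgy _ _ _ _ id); last exact: cvg_id.
by apply: nearW => m; rewrite (le_trans (ler_norm _))// ltW// normr_lt_hypot1.
Qed.

Lemma cvgy_asinh : @asinh R w @[w --> +oo] --> +oo.
Proof.
apply/cvgryPge => A; near=> w.
rewrite -[leLHS]expRK /asinh ler_ln ?posrE ?expR_gt0 ?asinh_arg_gt0//.
rewrite (@le_trans _ _ w)//; last by rewrite lerDl ltW// hypot1_gt0.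
Unshelve. all: by end_near. Qed.

Lemma cvgy_scale (a : R) : 0 < a -> a * w @[w --> +oo] --> +oo.
Proof.
move=> a0; apply/cvgryPge => A; near=> w; rewrite mulrC -ler_pdivrMr//.
Unshelve. all: by end_near. Qed.

Lemma substitution_scale (a : R) (G : R -> R) : 0 < a -> continuous G ->
  (forall x, 0 <= x -> 0 <= G x) ->
  (\int[mu]_(x in D) (G x)%:E = \int[mu]_(x in D) (G (a * x) * a)%:E)%E.
Proof.
move=> a0 cG G0.
apply: (@substitution_halfline _ G (fun x => a * x) (fun=> a) a) => //.
- by move=> x; apply: is_derive_eq; rewrite /GRing.scale/=; ring.
- by move=> x; exact: cvg_cst.
- by move=> x y _ _ xy; rewrite ltr_pM2l.
- by rewrite mulr0.
- exact: cvg_cst.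
- exact: cvgy_scale.
- exact: continuous_subspaceT.
Qed.

(** Used with [C = 1], for [X = sinh p], and with [C = cosh p], for
    [Y = cosh p sinh q]. *)
Lemma substitution_asinh_scale (C : R) (G : R -> R) : 0 < C -> continuous G ->
  (forall x, 0 <= x -> 0 <= G x) ->
  (\int[mu]_(x in D) (G x)%:E =
   \int[mu]_(x in D) (G (asinh (C^-1 * x)) * (hypot1 (C^-1 * x))^-1 * C^-1)%:E)%E.
Proof.
move=> C0 cG G0; have C1 : 0 < C^-1 by rewrite invr_gt0.
rewrite (@substitution_halfline _ G asinh (fun x => (hypot1 x)^-1) 0
  (@is_derive_asinh R))//; first last.
- exact: continuous_subspaceT.
- exact: cvgy_asinh.
- exact: cvg_hypot1V.
- exact: asinh0.
- exact: homo_asinh.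
- exact: continuous_hypot1V.
rewrite (@substitution_scale _ (fun x => G (asinh x) * (hypot1 x)^-1) C1)//.
- by continuity.
- move=> x x0; rewrite mulr_ge0 ?invr_ge0 ?(ltW (hypot1_gt0 _))// G0//.
  by rewrite -(asinh0 (R := R)) ler_ln ?posrE ?asinh_arg_gt0// lerD// ler_wsqrtr// lerD2l
    lerXn2r// ?nnegrE.
Qed.

Lemma hypot1_mulhypot1 (X Y : R) :
  hypot1 X * hypot1 ((hypot1 X)^-1 * Y) = hypot1 (Num.sqrt (X ^+ 2 + Y ^+ 2)).
Proof.
have h0 := hypot1_neq0 X.
apply/eqP; rewrite -(@eqrXn2 _ 2) ?mulr_ge0 ?(ltW (hypot1_gt0 _))//.
rewrite exprMn !sqr_hypot1 sqr_sqrtr ?addr_ge0 ?sqr_ge0// exprMn exprVn sqr_hypot1.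
apply/eqP; field.
by rewrite gt_eqF// hypot1_arg_gt0.
Qed.

Lemma radial_ge0 x s : 0 <= radial x s.
Proof. by rewrite mulr_ge0 ?expR_ge0// invr_ge0 ltW// hypot1_gt0. Qed.

Lemma continuous_radial x : continuous (radial x).
Proof. by rewrite /radial; continuity. Qed.

Lemma continuous_profile c : continuous c -> continuous (profile c).
Proof. by move=> cc; rewrite /profile; continuity. Qed.

Lemma profile_ge0 c w : (forall p, 0 <= c p) -> 0 <= profile c w.
Proof. by move=> c0; rewrite mulr_ge0// invr_ge0 ltW// hypot1_gt0. Qed.

(** With [X = sinh p] and [Y = cosh p sinh q] one has
    [cosh p * cosh q = sqrt (1 + X ^ 2 + Y ^ 2)], and [dX dY] is [cosh p] times
    [sqrt (1 + X ^ 2 + Y ^ 2)] times [dp dq]. *)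
Lemma hyperbolic_to_cartesian x c : continuous c -> (forall p, 0 <= c p) ->
  (\int[mu]_(q in D) \int[mu]_(p in D)
     (expR (- (x * coshR p * coshR q)) * c p)%:E =
   \int[mu]_(Y in D) \int[mu]_(X in D)
     (radial x (Num.sqrt (X ^+ 2 + Y ^+ 2)) * profile c X)%:E)%E.
Proof.
move=> cc c0; have mD : measurable (D : set TR) by exact: measurable_itv.
transitivity (\int[mu]_(q in D) \int[mu]_(X in D)
    (expR (- (x * hypot1 X * coshR q)) * profile c X)%:E)%E.
  apply: eq_integral => q _.
  pose G (p : R) := expR (- (x * coshR p * coshR q)) * c p.
  have cG : continuous G by rewrite /G; continuity.
  have G0 p : 0 <= p -> 0 <= G p by rewrite mulr_ge0 ?expR_ge0.
  rewrite (substitution_asinh_scale ltr01 cG G0).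
  apply: eq_integral => X _; congr (_%:E).
  by rewrite /G invr1 mul1r mulr1 cosh_asinh /profile mulrA.
have T1 := @tonelli R D D (fun z : TR * TR =>
  expR (- (x * hypot1 z.2 * coshR z.1)) * profile c z.2) mD mD.
rewrite T1; last 2 first.
- by have cp := continuous_profile cc; measurability.
- by move=> z; rewrite mulr_ge0 ?expR_ge0 ?profile_ge0.
rewrite {T1}.
have T2 := @tonelli R D D (fun z : TR * TR =>
  radial x (Num.sqrt (z.2 ^+ 2 + z.1 ^+ 2)) * profile c z.2) mD mD.
rewrite T2; last 2 first.
- have cp := continuous_profile cc; have cr := @continuous_radial x.
  measurability.
- by move=> z; rewrite mulr_ge0 ?radial_ge0 ?profile_ge0.
apply: eq_integral => X _ /=.
pose G (q : R) := expR (- (x * hypot1 X * coshR q)) * profile c X.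
have cG : continuous G by rewrite /G; continuity.
have G0 q : 0 <= q -> 0 <= G q by rewrite mulr_ge0 ?expR_ge0 ?profile_ge0.
rewrite (substitution_asinh_scale (hypot1_gt0 X) cG G0).
apply: eq_integral => Y _; congr (_%:E).
rewrite /G cosh_asinh /radial -hypot1_mulhypot1 invfM (mulrA x); ring.
Qed.

(** Polar coordinates through the slope [m], the tangent of the angle from the
    [Y]-axis: [X = Y * m] at fixed [Y], then [Y = s / hypot1 m] at fixed [m], whence
    [X = s * sinatan m]. *)
Lemma cartesian_to_polar (Phi h : R -> R) : continuous Phi -> continuous h ->
  (forall s, 0 <= Phi s) -> (forall w, 0 <= h w) ->
  (\int[mu]_(Y in D) \int[mu]_(X in D) (Phi (Num.sqrt (X ^+ 2 + Y ^+ 2)) * h X)%:E =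
   \int[mu]_(m in D) \int[mu]_(s in D)
     (Phi s * h (s * sinatan m) * s * (oneDsqr m)^-1)%:E)%E.
Proof.
move=> cPhi ch Phi0 h0.
have mD : measurable (D : set TR) by exact: measurable_itv.
have mD0 : measurable (`]0%R, +oo[ : set TR) by exact: measurable_itv.
pose W (X Y : R) := Phi (Num.sqrt (X ^+ 2 + Y ^+ 2)) * h X.
have W0 X Y : 0 <= W X Y by rewrite mulr_ge0.
(* [Num.sqrt (Y ^+ 2)] is the Jacobian [Y], written so as to be nonnegative and
   continuous on the whole line. *)
pose V (Y m : R) := W (Y * m) Y * Num.sqrt (Y ^+ 2).
have V0 Y m : 0 <= V Y m by rewrite mulr_ge0.
have mW : measurable_fun [set: TR * TR] (fun z => W z.2 z.1).
  by rewrite /W; measurability.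
have mV : measurable_fun [set: TR * TR] (fun z => V z.1 z.2).
  by rewrite /V /W; measurability.
rewrite -integral_itv_obnd_cbnd; last first.
  by apply: measurable_funTS; exact: (@measurable_inner R _ TR D (fun z => W z.2 z.1)).
transitivity (\int[mu]_(Y in `]0%R, +oo[) \int[mu]_(m in D) (V Y m)%:E)%E.
  apply: eq_integral => Y; rewrite inE/= in_itv/= andbT => Y0.
  have cG : continuous (W ^~ Y) by rewrite /W; continuity.
  rewrite (substitution_scale Y0 cG)//.
  by apply: eq_integral => m _; rewrite /V sqrtr_sqr gtr0_norm.
have T := tonelli mD0 mD mV (fun z => V0 z.1 z.2); rewrite /= in T.
rewrite {}T; apply: eq_integral => m _.
have cG : continuous (V ^~ m) by rewrite /V /W; continuity.
rewrite integral_itv_obnd_cbnd; last first.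
  apply/measurable_EFinP; apply: measurable_funTS.
  exact: continuous_measurable_fun.
have a0 : 0 < (hypot1 m)^-1 by rewrite invr_gt0 hypot1_gt0.
rewrite (substitution_scale a0 cG)//.
apply: eq_integral => s; rewrite inE /D/= in_itv/= andbT => s0; congr (_%:E).
have -> : (oneDsqr m)^-1 = (hypot1 m)^-1 ^+ 2 by rewrite exprVn sqr_hypot1.
rewrite /V /W; set a := (hypot1 m)^-1 in a0 *.
have -> : a * s * m = s * sinatan m by rewrite /sinatan -/a; ring.
have -> : (s * sinatan m) ^+ 2 + (a * s) ^+ 2 = s ^+ 2.
  rewrite /sinatan -/a; transitivity (s ^+ 2 * (a ^+ 2 * (1 + m ^+ 2))); first by ring.
  by rewrite -sqr_hypot1 -exprMn mulVf ?hypot1_neq0// expr1n mulr1.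
rewrite !sqrtr_sqr ger0_norm// ger0_norm ?mulr_ge0 ?(ltW a0)//; ring.
Qed.

Lemma shift_sqrt_hypot1 s : 0 <= s -> shift_sqrt (hypot1 s - 1) = s.
Proof.
move=> s0; rewrite /shift_sqrt.
have -> : (hypot1 s - 1) ^+ 2 + 2 * (hypot1 s - 1) = hypot1 s ^+ 2 - 1 by ring.
by rewrite sqr_hypot1 addrC addrA addNr add0r sqrtr_sqr ger0_norm.
Qed.

(** The variable [t = hypot1 s - 1], for which [dt = s / hypot1 s * ds] and
    [shift_sqrt t = s], turns the radial weight into a Laplace exponential. *)
Lemma radial_to_laplace x (h : R -> R) (k : R) : continuous h ->
  (forall w, 0 <= h w) ->
  (\int[mu]_(t in D) (expR (- (x * (1 + t))) * h (shift_sqrt t * k))%:E =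
   \int[mu]_(s in D) (radial x s * h (s * k) * s)%:E)%E.
Proof.
move=> ch h0.
pose G t := expR (- (x * (1 + t))) * h (shift_sqrt t * k).
have cG : continuous G by rewrite /G /shift_sqrt; continuity.
have G0 t : 0 <= G t by rewrite mulr_ge0 ?expR_ge0.
have dT (s : R) : is_derive s 1 (fun s => hypot1 s - 1) (s / hypot1 s).
  have D1 := is_derive_hypot1 s.
  by apply: is_derive_eq; rewrite subr0.
rewrite (substitution_halfline (l := 1) (G := G) dT)//.
- apply: eq_integral => s; rewrite inE /D/= in_itv/= andbT => s0; congr (_%:E).
  by rewrite /G shift_sqrt_hypot1// addrC subrK /radial; ring.
- by continuity.
- by move=> a b a0 b0 ab; rewrite ltrD2r homo_hypot1.
- by rewrite /hypot1 expr0n addr0 sqrtr1 subrr.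
- have H : 1 - (hypot1 s)^-1 @[s --> +oo] --> (1 : R).
    rewrite -[X in _ --> X]subr0; apply: cvgB; [exact: cvg_cst|exact: cvg_hypot1V].
  apply: (squeeze_cvgr (f := fun s => 1 - (hypot1 s)^-1) (h := cst 1) _ H); last exact: cvg_cst.
  near=> s; have s0 : 0 <= s by near: s; exact: nbhs_pinfty_ge.
  have hs := normr_lt_hypot1 s; rewrite ger0_norm// in hs.
  rewrite /cst [X in _ && X]ler_pdivrMr ?hypot1_gt0// mul1r (ltW hs) andbT.
  rewrite ler_pdivlMr ?hypot1_gt0// mulrBl mul1r mulVf ?hypot1_neq0//.
  rewrite lerBlDr -(@ler_pXn2r _ 2) ?nnegrE ?addr_ge0 ?(ltW (hypot1_gt0 _))//.
  by rewrite sqr_hypot1 sqrrD expr1n mulr1 addrC lerD2r lerDl mulrn_wge0.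
- rewrite -[X in _ --> X]/(+oo).
  apply/cvgryPge => A; have := @cvgy_hypot1 => /cvgryPge/(_ (A + 1)).
  by apply: filterS => s; rewrite lerBrDr.
- exact: continuous_subspaceT.
Unshelve. all: by end_near. Qed.

Lemma shift_sqrt_ge0 t : 0 <= shift_sqrt t. Proof. exact: sqrtr_ge0. Qed.

Lemma hyperbolic_to_laplace x c : continuous c -> (forall p, 0 <= c p) ->
  (\int[mu]_(q in D) \int[mu]_(p in D)
     (expR (- (x * coshR p * coshR q)) * c p)%:E =
   \int[mu]_(t in D) \int[mu]_(m in D)
     (expR (- (x * (1 + t))) * profile c (shift_sqrt t * sinatan m) * (oneDsqr m)^-1)%:E)%E.
Proof.
move=> cc c0; have mD : measurable (D : set TR) by exact: measurable_itv.
have cp := continuous_profile cc; have p0 w := profile_ge0 w c0.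
have oV0 m : 0 <= (oneDsqr m)^-1 by rewrite invr_ge0.
rewrite (hyperbolic_to_cartesian x cc c0).
rewrite (cartesian_to_polar (@continuous_radial x) cp (radial_ge0 x) p0).
pose f (z : TR * TR) :=
  expR (- (x * (1 + z.1))) * profile c (shift_sqrt z.1 * sinatan z.2) * (oneDsqr z.2)^-1.
have mf : measurable_fun [set: TR * TR] f by rewrite /f /shift_sqrt; measurability.
have f0 z : 0 <= f z.
  by apply: mulr_ge0 => //; apply: mulr_ge0 => //; exact: expR_ge0.
have T := tonelli mD mD mf f0; rewrite /f/= in T; rewrite {}T.
apply: eq_integral => m _.
pose h w := profile c w * (oneDsqr m)^-1.
have ch : continuous h by rewrite /h; continuity.
have h0 w : 0 <= h w by rewrite mulr_ge0.
have T := radial_to_laplace x (sinatan m) ch h0; rewrite /h in T.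
transitivity (\int[mu]_(s in D) (radial x s * (profile c (s * sinatan m) / oneDsqr m) * s)%:E)%E.
  by apply: eq_integral => s _; congr (_%:E); ring.
rewrite -T; apply: eq_integral => t _; congr (_%:E); ring.
Qed.

End PolarCoordinates.

(** * The square of a Macdonald function as a Laplace integral *)
Section ProductFormula.
Context {R : realType}.
Notation mu := (@lebesgue_measure R).
Notation TR := (measurableTypeR R).
Implicit Types (x s m t w u v tau : R).
Let D : set R := `[0, +oo[.

Let mD : measurable (D : set TR). Proof. exact: measurable_itv. Qed.

Lemma integral_EFin_lin (f g : R -> R) (a b : R) :
  mu.-integrable D (EFin \o f) -> mu.-integrable D (EFin \o g) ->
  (\int[mu]_(u in D) (a * f u + b * g u)%:E =
   (a * (\int[mu]_(u in D) f u)%R + b * (\int[mu]_(u in D) g u)%R)%:E)%E.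
Proof.
move=> If Ig; have Jf := integrableRZl a mD If; have Jg := integrableRZl b mD Ig.
have J := integrableRD mD Jf Jg.
rewrite -!RintegralZl//; try exact: mD.
rewrite -(RintegralD mD Jf Jg) /Rintegral fineK//.
exact: (@integrable_fin_num _ _ R mu D mD _ J).
Qed.

Lemma integral_expRN x : 0 < x ->
  (\int[mu]_(t in D) (expR (- (x * t)))%:E = (x^-1)%:E)%E.
Proof.
move=> x0; pose F (t : R) := - (x^-1 * expR (- (x * t))).
have dE (t : R) : is_derive t 1 (fun t => expR (- (x * t))) (- x * expR (- (x * t))).
  have D1 : is_derive t 1 (fun t => - (x * t)) (- x).
    by apply: is_derive_eq; rewrite /GRing.scale/=; ring.
  have := @is_derive1_comp _ (@expR R) (fun t => - (x * t)) t _ _ (is_derive_expR _) D1.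
  by rewrite mulrC.
have dF (t : R) : is_derive t 1 F (expR (- (x * t))).
  have D1 := dE t; apply: is_derive_eq; rewrite /GRing.scale/=; field.
  by rewrite gt_eqF.
rewrite (@ge0_continuous_FTC2y _ _ F 0 0).
- by rewrite /F mulr0 oppr0 expR0 mulr1 sub0e EFinN oppeK.
- by move=> t _; exact: expR_ge0.
- by apply: continuous_subspaceT; continuity.
- rewrite -oppr0; apply: cvgN; rewrite -[X in _ --> X](mulr0 x^-1).
  apply: cvgM; first exact: cvg_cst.
  apply: (@cvg_comp _ _ _ (fun t => x * t) (fun t => expR (- t)) _ +oo).
    exact: cvgy_scale.
  exact: cvgr_expR.
- by move=> t _; case: (dF t).
- by apply: cvg_at_right_filter; exact: is_derive_continuous (dF 0).
- by move=> t _; rewrite derive1E; case: (dF t).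
Qed.

Lemma integrable_expRN x : 0 < x ->
  mu.-integrable D (EFin \o (fun t => expR (- (x * t)))).
Proof.
move=> x0; apply/integrableP; split.
  apply/measurable_EFinP; apply: measurable_funTS.
  by apply: continuous_measurable_fun; continuity.
under eq_integral do rewrite /= ger0_norm ?expR_ge0//.
by rewrite integral_expRN// ltry.
Qed.

Definition bessel_weight x u : R := expR (- (x / 2 * coshR u)).

Lemma continuous_bessel_weight x : continuous (bessel_weight x).
Proof. by rewrite /bessel_weight; continuity. Qed.

(** Since [expR y >= y], the weight is dominated by a multiple of [expR (- u)]. *)
Lemma integrable_bessel_weight x : 0 < x ->
  mu.-integrable D (EFin \o (bessel_weight x)).
Proof.
move=> x0; have I := integrableRZl (4 / x) mD (integrable_expRN ltr01).
apply: (le_integrableR mD _ _ I).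
  by apply: measurable_funTS; apply: continuous_measurable_fun; exact: continuous_bessel_weight.
move=> u _; rewrite ger0_norm ?expR_ge0// mul1r /bessel_weight expRN.
have e0 := expR_gt0 u; have e1 := expR_gt0 (- u).
have h : x / 4 * expR u <= x / 2 * coshR u.
  by rewrite /coshR; have := mulr_gt0 x0 e1; lra.
have h2 : x / 4 * expR u <= expR (x / 2 * coshR u).
  by apply: le_trans h _; have := expR_ge1Dx (x / 2 * coshR u); lra.
have -> : 4 / x * expR (- u) = (x / 4 * expR u)^-1.
  by rewrite expRN invfM invf_div.
by rewrite lef_pV2// posrE ?expR_gt0// mulr_gt0// divr_gt0.
Qed.

(** The real form of the Macdonald function of order [i tau] at [x / 2]. *)
Definition bessel_integral x tau : R :=
  \int[mu]_(u in D) (bessel_weight x u * cos (tau * u)).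

Lemma integrable_bessel x tau : 0 < x ->
  mu.-integrable D (EFin \o (fun u => bessel_weight x u * cos (tau * u))).
Proof.
move=> x0; apply: (le_integrableR mD _ _ (integrable_bessel_weight x0)).
  apply: measurable_funTS; apply: continuous_measurable_fun.
  by rewrite /bessel_weight; continuity.
move=> u _; rewrite normrM ger0_norm ?expR_ge0// -[leRHS]mulr1 ler_wpM2l ?expR_ge0//.
exact: normr_cos.
Qed.

(** Adding 1 to the cosine keeps the integrands nonnegative, so that the whole
    computation goes through Tonelli's theorem; the factor 4 counts the quadrants. *)
Let c4 tau u : R := 4 * (1 + cos (2 * tau * u)).

Let c4_ge0 tau u : 0 <= c4 tau u.
Proof. by rewrite /c4 mulr_ge0//; have := cos_geN1 (2 * tau * u); lra. Qed.

Let profile_c4 tau w : profile (c4 tau) w = 4 * mehler 0 w + 4 * mehler tau w.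
Proof. by rewrite /profile /c4 /mehler mulr0 mul0r cos0; ring. Qed.

Let cc4 tau : continuous (c4 tau).
Proof. by rewrite /c4; continuity. Qed.

Definition laplace_conical x tau : R :=
  \int[mu]_(t in D) (expR (- (x * (1 + t))) * conical tau (shift_sqrt t)).

Lemma continuous_conical tau : continuous (conical tau).
Proof. by move=> s; exact: is_derive_continuous (is_derive_conical tau s). Qed.

Lemma integrable_laplace_conical x tau : 0 < x ->
  mu.-integrable D (EFin \o
    (fun t => expR (- (x * (1 + t))) * conical tau (shift_sqrt t))).
Proof.
move=> x0; apply: (le_integrableR mD _ _ (integrable_expRN x0)).
  apply: measurable_funTS; apply: continuous_measurable_fun.
  by have cN := @continuous_conical tau; rewrite /shift_sqrt; continuity.
move=> t _; rewrite normrM ger0_norm ?expR_ge0// -[leRHS]mulr1.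
apply: ler_pM; [exact: expR_ge0|exact: normr_ge0| |exact: normr_conical].
by rewrite ler_expR lerN2 ler_wpM2l ?(ltW x0)// lerDr.
Qed.

Lemma quadrant_integral x tau : 0 < x ->
  (\int[mu]_(q in D) \int[mu]_(p in D)
     (expR (- (x * coshR p * coshR q)) * c4 tau p)%:E =
   (2 * pi * laplace_conical x 0 + 2 * pi * laplace_conical x tau)%:E)%E.
Proof.
move=> x0; rewrite (hyperbolic_to_laplace x (@cc4 tau) (c4_ge0 tau)).
rewrite /laplace_conical -integral_EFin_lin; last 2 first.
- exact: integrable_laplace_conical.
- exact: integrable_laplace_conical.
apply: eq_integral => t _; set e := expR _; set s := shift_sqrt t.
have I0 := integrable_avg 0 s (@continuous_mehler R 0) (normr_mehler 0).
have I1 := integrable_avg 0 s (@continuous_mehler R tau) (normr_mehler tau).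
transitivity (\int[mu]_(m in D)
   (4 * e * (sinatan m ^+ 0 * mehler 0 (s * sinatan m) / oneDsqr m) +
    4 * e * (sinatan m ^+ 0 * mehler tau (s * sinatan m) / oneDsqr m))%:E)%E.
  by apply: eq_integral => m _; congr (_%:E); rewrite profile_c4 expr0; ring.
rewrite integral_EFin_lin// -/(avg 0 (mehler 0) s) -/(avg 0 (mehler tau) s).
have pi0 : pi != 0 :> R by rewrite gt_eqF// pi_gt0.
congr (_%:E); rewrite /conical.
have key (a : R) : 2 * pi * (e * (2 / pi * a)) = 4 * e * a.
  transitivity (4 * e * a * (pi * pi^-1)); first by ring.
  by rewrite mulfV// mulr1.
by rewrite !key.
Qed.

(** In the variables [u = p + q], [v = p - q] the product of the two weights is
    [expR (- x cosh p cosh q)] and the product of the two cosines is half the sum of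
    [cos (2 tau p)] and [cos (2 tau q)]; the two summands contribute equally by symmetry. *)
Lemma plane_integral x tau : 0 < x ->
  (\int[mu]_u \int[mu]_v
     (bessel_weight x u * bessel_weight x v * (1 + cos (tau * u) * cos (tau * v)))%:E =
   (4 * pi * (laplace_conical x 0 + laplace_conical x tau))%:E)%E.
Proof.
move=> x0.
pose F (z : TR * TR) := bessel_weight x z.1 * bessel_weight x z.2 *
  (1 + cos (tau * z.1) * cos (tau * z.2)).
have F0 z : 0 <= F z by rewrite mulr_ge0// ?mulr_ge0 ?expR_ge0.
have mF : measurable_fun [set: TR * TR] F by rewrite /F /bessel_weight; measurability.
rewrite (rotation mF F0); last 2 first.
- by move=> u; rewrite /F/= /bessel_weight; continuity.
- by move=> p; rewrite /F/= /bessel_weight; continuity.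
pose E (p q : R) := expR (- (x * coshR p * coshR q)).
pose H (z : TR * TR) := E z.1 z.2 * (4^-1 * c4 tau z.1 + 4^-1 * c4 tau z.2).
transitivity (\int[mu]_p \int[mu]_q (H (p, q))%:E)%E.
  apply: eq_integral => p _; apply: eq_integral => q _; congr (_%:E).
  rewrite /F /H /E /bessel_weight /c4 /= -expRD.
  have -> : - (x / 2 * coshR (p + q)) + - (x / 2 * coshR (p - q)) =
      - (x * coshR p * coshR q).
    transitivity (- (x / 2 * (coshR (p + q) + coshR (p - q)))); first by ring.
    by rewrite coshRD_coshRB; field.
  have cD : cos (tau * (p + q)) * cos (tau * (p - q)) =
      (cos (2 * tau * p) + cos (2 * tau * q)) / 2.
    have -> : 2 * tau * p = tau * (p + q) + tau * (p - q) by ring.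
    have -> : 2 * tau * q = tau * (p + q) - tau * (p - q) by ring.
    by rewrite cosD cosB; field.
  by rewrite cD; field.
have H0 z : 0 <= H z by rewrite mulr_ge0 ?expR_ge0// addr_ge0// mulr_ge0// c4_ge0.
have mH : measurable_fun [set: TR * TR] H by rewrite /H /E /c4; measurability.
rewrite (quadrant mH H0); first last.
- by move=> u v; rewrite /H /E /c4/= coshRN mulrN cosN.
- by move=> u v; rewrite /H /E /c4/= coshRN mulrN cosN.
- by move=> v; rewrite /H /E /c4/=; continuity.
- by move=> u; rewrite /H /E /c4/=; continuity.
have Q := quadrant_integral tau x0.
pose G1 (z : TR * TR) := E z.2 z.1 * c4 tau z.2.
pose G2 (z : TR * TR) := E z.2 z.1 * c4 tau z.1.
have G10 z : 0 <= G1 z by rewrite mulr_ge0 ?expR_ge0// c4_ge0.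
have G20 z : 0 <= G2 z by rewrite mulr_ge0 ?expR_ge0// c4_ge0.
have mG1 : measurable_fun [set: TR * TR] G1 by rewrite /G1 /E /c4; measurability.
have mG2 : measurable_fun [set: TR * TR] G2 by rewrite /G2 /E /c4; measurability.
have Q1 : (\int[mu]_(q in D) \int[mu]_(p in D) (G1 (q, p))%:E =
    (2 * pi * laplace_conical x 0 + 2 * pi * laplace_conical x tau)%:E)%E.
  by rewrite -Q.
have Q2 : (\int[mu]_(q in D) \int[mu]_(p in D) (G2 (q, p))%:E =
    (2 * pi * laplace_conical x 0 + 2 * pi * laplace_conical x tau)%:E)%E.
  rewrite (tonelli mD mD mG2 G20) -Q; apply: eq_integral => p _.
  by apply: eq_integral => q _; rewrite /G2/= /E mulrAC.
transitivity (\int[mu]_(q in D) (\int[mu]_(p in D) (G1 (q, p))%:E +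
    \int[mu]_(p in D) (G2 (q, p))%:E))%E.
  apply: eq_integral => q _; rewrite -ge0_integralD//.
  - by apply: eq_integral => p _; congr (_%:E); rewrite /H /G1 /G2/=; field.
  - by move=> p _; rewrite lee_fin.
  - apply/measurable_EFinP; apply: measurable_funTS; apply: continuous_measurable_fun.
    by rewrite /G1 /E /c4/=; continuity.
  - by move=> p _; rewrite lee_fin.
  - apply/measurable_EFinP; apply: measurable_funTS; apply: continuous_measurable_fun.
    by rewrite /G2 /E /c4/=; continuity.
rewrite ge0_integralD//; first last.
- by apply: measurable_funTS; exact: measurable_inner.
- by move=> q _; apply: integral_ge0 => p _; rewrite lee_fin.
- by apply: measurable_funTS; exact: measurable_inner.
- by move=> q _; apply: integral_ge0 => p _; rewrite lee_fin.
have dbl (a b c : R) : (2 * a * b + 2 * a * c) + (2 * a * b + 2 * a * c) = 4 * a * (b + c).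
  by ring.
by rewrite Q1 Q2 -EFinD dbl.
Qed.

(** The other evaluation of the integral of [plane_integral]: over a quadrant it splits
    into products of one-dimensional integrals. *)
Lemma bessel_integral_sqr_sum x tau : 0 < x ->
  bessel_integral x 0 ^+ 2 + bessel_integral x tau ^+ 2 =
  pi * (laplace_conical x 0 + laplace_conical x tau).
Proof.
move=> x0; have P := plane_integral tau x0.
pose F (z : TR * TR) := bessel_weight x z.1 * bessel_weight x z.2 *
  (1 + cos (tau * z.1) * cos (tau * z.2)).
have F0 z : 0 <= F z by rewrite mulr_ge0// ?mulr_ge0 ?expR_ge0.
have mF : measurable_fun [set: TR * TR] F by rewrite /F /bessel_weight; measurability.
have Q := quadrant mF F0.
rewrite {1}/F /= in Q; rewrite {}Q in P; first last.
- by move=> u v; rewrite /F /bessel_weight/= coshRN mulrN cosN.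
- by move=> u v; rewrite /F /bessel_weight/= coshRN mulrN cosN.
- by move=> v; rewrite /F /bessel_weight/=; continuity.
- by move=> u; rewrite /F /bessel_weight/=; continuity.
have I0 := integrable_bessel 0 x0; have I1 := integrable_bessel tau x0.
have E : (\int[mu]_(v in D) \int[mu]_(u in D) (4 * F (u, v))%:E =
    (4 * bessel_integral x 0 * bessel_integral x 0 +
     4 * bessel_integral x tau * bessel_integral x tau)%:E)%E.
  transitivity (\int[mu]_(v in D)
     (4 * bessel_integral x 0 * (bessel_weight x v * cos (0 * v)) +
      4 * bessel_integral x tau * (bessel_weight x v * cos (tau * v)))%:E)%E.
    apply: eq_integral => v _.
    transitivity (\int[mu]_(u in D)
      (4 * bessel_weight x v * (bessel_weight x u * cos (0 * u)) +
       4 * bessel_weight x v * cos (tau * v) * (bessel_weight x u * cos (tau * u)))%:E)%E.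
      by apply: eq_integral => u _; congr (_%:E); rewrite /F/= mul0r cos0; ring.
    rewrite integral_EFin_lin// -/(bessel_integral x 0) -/(bessel_integral x tau).
    by congr (_%:E); rewrite mul0r cos0; ring.
  by rewrite integral_EFin_lin.
move: P; rewrite E => -[P].
have : 4 * (bessel_integral x 0 ^+ 2 + bessel_integral x tau ^+ 2) =
  4 * (pi * (laplace_conical x 0 + laplace_conical x tau)).
  by rewrite mulrA -P; ring.
by move/mulfI; apply.
Qed.

(** The case [tau = 0] gives the term that was added for the sake of positivity. *)
Lemma bessel_integral_sqr x tau : 0 < x ->
  bessel_integral x tau ^+ 2 = pi * laplace_conical x tau.
Proof.
move=> x0; have E0 := bessel_integral_sqr_sum 0 x0.
have E := bessel_integral_sqr_sum tau x0.
have E1 : bessel_integral x 0 ^+ 2 = pi * laplace_conical x 0.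
  move: E0; rewrite -mulr2n -mulr2n mulrnAr.
  by move=> /eqP; rewrite eqrMn2r//= => /eqP.
by move: E; rewrite E1 mulrDr => /addrI.
Qed.

End ProductFormula.

Local Open Scope complex_scope.

(** * Limits and power series in the complex plane *)
Section ComplexLimits.
Context {R : realType}.
Implicit Types (u : nat -> R[i]) (z s : R[i]).

Lemma normc_cmod z : `|z| = (cmod z)%:C.
Proof. by []. Qed.

Lemma normr_Re_le z : `|complex.Re z| <= cmod z.
Proof.
case: z => a b /=; rewrite /cmod/= -sqrtr_sqr ler_wsqrtr//.
by rewrite lerDl sqr_ge0.
Qed.

Lemma normr_Im_le z : `|complex.Im z| <= cmod z.
Proof.
case: z => a b /=; rewrite /cmod/= -sqrtr_sqr ler_wsqrtr//.
by rewrite lerDr sqr_ge0.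
Qed.

Lemma cmod_le z : cmod z <= `|complex.Re z| + `|complex.Im z|.
Proof.
case: z => a b /=; rewrite /cmod/=.
rewrite -[leRHS]ger0_norm ?addr_ge0// -sqrtr_sqr ler_wsqrtr//.
rewrite sqrrD !real_normK ?num_real// lerD2r lerDl.
by rewrite mulrn_wge0// mulr_ge0.
Qed.

Lemma cvg_complexP (T : Type) (F : set_system T) (FF : Filter F)
    (g : T -> R[i]) (s : R[i]) :
  (g : T -> R[i]^o) @ F --> (s : R[i]^o) <->
  (fun x => complex.Re (g x)) @ F --> complex.Re s /\
  (fun x => complex.Im (g x)) @ F --> complex.Im s.
Proof.
split=> [gs|[gr gi]].
- split; apply/cvgrPdist_lt => e e0.
  + have := (@cvgrPdist_lt _ R[i]^o _ F FF g s).1 gs (e%:C) _.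
    rewrite ltcR => /(_ e0); apply: filterS => x; rewrite normc_cmod ltcR.
    by apply: le_lt_trans; rewrite -raddfB; exact: normr_Re_le.
  + have := (@cvgrPdist_lt _ R[i]^o _ F FF g s).1 gs (e%:C) _.
    rewrite ltcR => /(_ e0); apply: filterS => x; rewrite normc_cmod ltcR.
    by apply: le_lt_trans; rewrite -raddfB; exact: normr_Im_le.
- apply/(@cvgrPdist_lt _ R[i]^o _ F FF g s) => e.
  rewrite ltcE/= => /andP[/eqP ei er].
  have e2 : 0 < complex.Re e / 2 by rewrite divr_gt0.
  have /cvgrPdist_lt/(_ _ e2) := gr; have /cvgrPdist_lt/(_ _ e2) := gi.
  apply: filterS2 => x hi hr; rewrite normc_cmod ltcE/= -ei eqxx/=.
  apply: (le_lt_trans (cmod_le _)); rewrite !raddfB/=; lra.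
Qed.

(** At real points the powers are real, so that the real and imaginary parts of a series
    are the series of the real and imaginary parts of its coefficients. *)
Lemma power_series_atP u (z0 z : R) (s : R[i]) : power_series_at u z0 z s <->
  pseries (fun n => complex.Re (u n)) (z - z0) @ \oo --> complex.Re s /\
  pseries (fun n => complex.Im (u n)) (z - z0) @ \oo --> complex.Im s.
Proof.
rewrite /power_series_at cvg_complexP.
have term n : u n * (z - z0)%:C ^+ n =
    (complex.Re (u n) * (z - z0) ^+ n) +i* (complex.Im (u n) * (z - z0) ^+ n).
  rewrite -rmorphXn; case: (u n) => a b /=.
  by apply/eqP; rewrite eq_complex/= !mulr0 subr0 add0r !eqxx.
have -> : (fun n => complex.Re (series (fun n => u n * (z - z0)%:C ^+ n : R[i]^o) n)) =
    pseries (fun n => complex.Re (u n)) (z - z0).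
  apply/funext => n; rewrite /series /pseries /series/= raddf_sum.
  by apply: eq_bigr => i _; rewrite term.
have -> // : (fun n => complex.Im (series (fun n => u n * (z - z0)%:C ^+ n : R[i]^o) n)) =
    pseries (fun n => complex.Im (u n)) (z - z0).
apply/funext => n; rewrite /series /pseries /series/= raddf_sum.
by apply: eq_bigr => i _; rewrite term.
Qed.

Lemma cvg_pseries0 (x : R) : pseries (fun=> 0) x @ \oo --> (0 : R).
Proof.
rewrite (_ : pseries _ x = cst 0); first exact: cvg_cst.
by apply/funext => n; rewrite /pseries /series/= big1// => i _; rewrite mul0r.
Qed.

Lemma power_series_at_real (c : R^nat) (z0 z s : R) :
  pseries c (z - z0) @ \oo --> s ->
  power_series_at (fun n => (c n)%:C) z0 z s%:C.
Proof. by move=> cs; apply/power_series_atP; split=> //=; exact: cvg_pseries0. Qed.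

End ComplexLimits.

(** * The Olevskii kernel as a conical function *)
Section GaussFunction.
Context {R : realType}.
Implicit Types (tau z t x : R).

Let ha tau : R[i] := 2^-1 -i* tau.
Let hb tau : R[i] := 2^-1 +i* tau.

Lemma gauss_coef_conical tau n : gauss_coef (ha tau) (hb tau) 1 n = (conical_coef tau n)%:C.
Proof.
have poch1 : pochhammer (1 : R[i]) n = n`!%:R.
  rewrite /pochhammer; elim: n => [|n IH]; first by rewrite big_ord0.
  by rewrite big_ord_recr/= IH factS mulnC natrM nat1r.
rewrite /gauss_coef poch1 /pochhammer -big_split/= /conical_coef.
rewrite rmorphM rmorph_prod fmorphV rmorphXn/= rmorph_nat expr2; congr (_ * _).
apply: eq_bigr => k _; rewrite /ha /hb.
have -> : (k%:R : R[i]) = (k%:R : R)%:C by rewrite rmorph_nat.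
by apply/eqP; rewrite eq_complex/=; apply/andP; split; apply/eqP; ring.
Qed.

Lemma hypR_is_hyp2F1 tau :
  is_hyp2F1 (ha tau) (hb tau) 1 (fun z => (hypR tau z)%:C).
Proof.
split.
- move=> z0; rewrite /= in_itv/= => z01.
  have [c [r [r0 cr]]] := hypR_analytic tau z01.
  exists (fun n => (c n)%:C), r; split => // z zr.
  by apply: power_series_at_real; exact: cr.
- move=> z z1; rewrite (_ : gauss_coef _ _ _ = (fun n => (conical_coef tau n)%:C)).
    apply: power_series_at_real; rewrite subr0 hypR_gauss//.
    exact: cvg_pseries (conical_coef_bound tau) z1.
  by apply/funext => n; exact: gauss_coef_conical.
Qed.

Lemma pseriesB (c d : R^nat) z (l m : R) : pseries c z @ \oo --> l ->
  pseries d z @ \oo --> m -> pseries (fun n => c n - d n) z @ \oo --> l - m.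
Proof.
move=> cl dm; rewrite (_ : pseries _ z = pseries c z - pseries d z).
  exact: cvgB cl dm.
apply/funext => n; rewrite /pseries /series.
transitivity (\sum_(0 <= k < n) c k * z ^+ k - \sum_(0 <= k < n) d k * z ^+ k) => //.
by rewrite -sumrB/=; apply: eq_bigr => i _; rewrite mulrBl.
Qed.

(** The real and imaginary parts of the difference are analytic and vanish on ]-1, 1[. *)
Lemma is_hyp2F1_unique (a b c : R[i]) (f g : R -> R[i]) :
  is_hyp2F1 a b c f -> is_hyp2F1 a b c g -> forall z, z < 1 -> f z = g z.
Proof.
move=> [fa fs] [ga gs].
(* [P] stands for the real or for the imaginary part. *)
have main (P : R[i] -> R) : (forall u (z0 z : R) s, power_series_at u z0 z s ->
    pseries (fun n => P (u n)) (z - z0) @ \oo --> P s) ->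
    forall z, z < 1 -> P (f z) = P (g z).
  move=> HP z z1; apply/eqP; rewrite -subr_eq0; apply/eqP.
  apply: (@analytic_continuation_unique _ (fun z => P (f z) - P (g z)) 1) => //.
  - move=> z0 z01.
    have [u [r [r0 ur]]] := fa z0 z01; have [v [q [q0 vq]]] := ga z0 z01.
    exists (fun n => P (u n) - P (v n)), (Num.min r q); split.
      by rewrite lt_min r0.
    move=> y; rewrite lt_min => /andP[yr yq]; apply: pseriesB.
      by apply: HP; exact: ur.
    by apply: HP; exact: vq.
  - move=> y y1; apply/eqP; rewrite subr_eq0; apply/eqP.
    have h1 := HP _ _ _ _ (fs y y1); have h2 := HP _ _ _ _ (gs y y1).
    exact: (cvg_unique (@norm_hausdorff _ _) h1 h2).
move=> z z1; apply/eqP; rewrite eq_complex; apply/andP; split; apply/eqP.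
- by apply: main => // u z0 y s /power_series_atP[].
- by apply: main => // u z0 y s /power_series_atP[].
Qed.

Lemma hyp2F1_hypR tau z : z < 1 -> hyp2F1 (ha tau) (hb tau) 1 z = (hypR tau z)%:C.
Proof.
move=> z1; have ex := hypR_is_hyp2F1 tau.
have gex : is_hyp2F1 (ha tau) (hb tau) 1 (hyp2F1 (ha tau) (hb tau) 1).
  rewrite /hyp2F1; apply: (@xgetPex _ (fun=> 0) [set g | is_hyp2F1 _ _ _ g]).
  by exists (fun z => (hypR tau z)%:C).
exact: is_hyp2F1_unique gex ex z z1.
Qed.

Lemma olevskii_kernel_conical t tau : 0 < t ->
  olevskii_kernel t tau = (conical tau (shift_sqrt t))%:C.
Proof.
move=> t0; rewrite /olevskii_kernel.
have q : 0 < t ^+ 2 + 2 * t by rewrite addr_gt0 ?exprn_gt0 ?mulr_gt0.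
have -> : - t ^+ 2 - 2 * t = - shift_sqrt t ^+ 2.
  by rewrite sqr_sqrtr ?ltW//; ring.
rewrite hyp2F1_hypR ?hypR_conical ?shift_sqrt_ge0//.
by rewrite (@le_lt_trans _ _ 0)// oppr_le0 sqr_ge0.
Qed.

End GaussFunction.

(** * The Macdonald function of imaginary order *)
Section MacdonaldReal.
Context {R : realType}.
Notation mu := (@lebesgue_measure R).
Implicit Types (tau z t x u : R).

Lemma cexp_real x : cexp x%:C = (expR x)%:C.
Proof.
rewrite /cexp/= cos0 sin0; apply/eqP.
by rewrite eq_complex/= !mulr0 mul0r mulr1 subr0 addr0 !eqxx.
Qed.

Lemma ccosh_real u : ccosh u%:C = (coshR u)%:C.
Proof.
rewrite /ccosh -rmorphN !cexp_real -rmorphD /coshR.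
by rewrite [RHS]rmorphM fmorphV rmorph_nat.
Qed.

Lemma ccosh_imaginary tau u : ccosh ((tau *i) * u%:C) = (cos (tau * u))%:C.
Proof.
have -> : (tau *i) * u%:C = (tau * u) *i.
  by apply/eqP; rewrite eq_complex/= !mul0r !mulr0 subr0 add0r !eqxx.
have E (y : R) : cexp (y *i) = cos y +i* sin y.
  by rewrite /cexp/= expR0 mul1r.
have N (y : R) : - (y *i) = (- y) *i :> R[i].
  by apply/eqP; rewrite eq_complex/= oppr0 !eqxx.
rewrite /ccosh N !E cosN sinN.
have -> : cos (tau * u) +i* sin (tau * u) + (cos (tau * u) +i* - sin (tau * u)) =
    (2 * cos (tau * u))%:C :> R[i].
  by apply/eqP; rewrite eq_complex/= addrN mulr_natl mulr2n !eqxx.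
rewrite rmorphM rmorph_nat mulrC mulrA mulVf ?mul1r//.
Qed.

Lemma cintegral_real (f : R -> R) (D : set R) :
  cintegral D (fun t => (f t)%:C) = (\int[mu]_(t in D) f t)%:C.
Proof.
apply/eqP; rewrite eq_complex/= eqxx/=.
by rewrite /Rintegral integral0.
Qed.

Lemma index_kernel_bessel x tau :
  index_kernel x tau = (bessel_integral x tau ^+ 2)%:C.
Proof.
rewrite /index_kernel rmorphXn; congr (_ ^+ 2).
rewrite /macdonald.
have -> : (fun u : R => cexp (- ((x / 2)%:C * ccosh u%:C)) * ccosh (tau *i * u%:C)) =
    (fun u => (bessel_weight x u * cos (tau * u))%:C).
  apply/funext => u; rewrite ccosh_imaginary ccosh_real -rmorphM -rmorphN cexp_real.
  by rewrite -rmorphM.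
rewrite cintegral_real; congr (_%:C); rewrite /bessel_integral /Rintegral.
rewrite integral_itv_obnd_cbnd//.
apply/measurable_EFinP; apply: measurable_funTS; apply: continuous_measurable_fun.
by rewrite /bessel_weight; continuity.
Qed.

End MacdonaldReal.

(** * Composition of the Laplace and Olevskii transforms *)
Section LaplaceOlevskii.
Context {R : realType}.
Notation mu := (@lebesgue_measure R).
Notation TR := (measurableTypeR R).
Implicit Types (tau t x y : R) (phi : R -> R).
Let D : set R := `[0, +oo[.
Let D0 : set R := `]0, +oo[.

Let mD : measurable (D : set TR). Proof. exact: measurable_itv. Qed.
Let mD0 : measurable (D0 : set TR). Proof. exact: measurable_itv. Qed.

Definition olevskiiR tau t : R := conical tau (shift_sqrt t).

Lemma normr_olevskiiR tau t : `|olevskiiR tau t| <= 1. Proof. exact: normr_conical. Qed.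

(** Measurability of an integral in its parameters comes from Tonelli's theorem, hence
    for the nonnegative integrand [1 + mehler]; the constant is then subtracted. *)
Lemma measurable_olevskiiR : measurable_fun [set: TR * TR] (fun z => olevskiiR z.1 z.2).
Proof.
pose f (z : (TR * TR) * TR) :=
  (1 + mehler z.1.1 (shift_sqrt z.1.2 * sinatan z.2)) * (oneDsqr z.2)^-1.
have m1 : measurable_fun [set: (TR * TR) * TR] (fun z => z.1.1 : R).
  exact: measurableT_comp measurable_fst measurable_fst.
have m2 : measurable_fun [set: (TR * TR) * TR] (fun z => shift_sqrt z.1.2 : R).
  apply: (@measurable_compR _ _ _ (@shift_sqrt R) (fun z : (TR * TR) * TR => z.1.2)).
    by rewrite /shift_sqrt; continuity.
  exact: measurableT_comp measurable_snd measurable_fst.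
have m3 : measurable_fun [set: (TR * TR) * TR] (fun z => sinatan z.2).
  by measurability.
have m4 := measurable_funM m2 m3.
have m5 := measurable_compR (@continuous_asinh R) m4.
have m6 := measurable_compR (@continuous_cos R)
  (measurable_funM (measurable_funM (measurable_cst (2 : R)) m1) m5).
have m7 := measurable_funM m6 (measurable_compR (@continuous_hypot1V R) m4).
have m8 : measurable_fun [set: (TR * TR) * TR] (fun z => (oneDsqr z.2)^-1).
  by measurability.
have mf : measurable_fun [set: (TR * TR) * TR] f.
  exact: (measurable_funM (measurable_funD (measurable_cst (1 : R)) m7) m8).
have f0 z : 0 <= f z.
  rewrite mulr_ge0 ?invr_ge0//.
  have := normr_mehler z.1.1 (shift_sqrt z.1.2 * sinatan z.2).
  by rewrite ler_norml => /andP[h _]; lra.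
have M := measurable_inner mD mf f0.
pose g (z : TR * TR) : R := pi / 2 + avg 0 (mehler z.1) (shift_sqrt z.2).
have mg : measurable_fun [set: TR * TR] g.
  apply/measurable_EFinP; move: M; apply: eq_measurable_fun => z _.
  have I := integrable_avg 0 (shift_sqrt z.2) (@continuous_mehler R z.1) (normr_mehler z.1).
  have := @integral_EFin_lin R _ _ 1 1 (@integrable_oneDsqrV R) I.
  rewrite Rintegral_oneDsqrV !mul1r -/(avg 0 (mehler z.1) (shift_sqrt z.2)) /g /= => <-.
  by apply: eq_integral => m _; congr (_%:E); rewrite /f/= expr0; ring.
have -> : (fun z : TR * TR => olevskiiR z.1 z.2) = (fun z => 2 / pi * (g z - pi / 2)).
  by apply/funext => z; rewrite /olevskiiR /conical /g addrAC subrr add0r.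
apply: measurable_funM => //; exact: measurable_funB.
Qed.

Lemma measurable_olevskiiR1 t : measurable_fun [set: TR] (fun tau => olevskiiR tau t).
Proof. exact: (measurableT_comp measurable_olevskiiR (pair2_measurable t)). Qed.

Lemma measurable_olevskiiR2 tau : measurable_fun [set: TR] (fun t => olevskiiR tau t).
Proof. exact: (measurableT_comp measurable_olevskiiR (pair1_measurable tau)). Qed.

Lemma integrable_Laplace0 x : 0 < x -> mu.-integrable D0 (EFin \o (fun t => expR (- (x * t)))).
Proof.
move=> x0; apply: (@integrableS _ _ R mu D D0 _ mD mD0 _ (integrable_expRN x0)).
by move=> t; rewrite /D0 /D /= !in_itv/= !andbT; exact: ltW.
Qed.

Lemma Rintegral_Laplace0 x : 0 < x -> \int[mu]_(t in D0) expR (- (x * t)) = x^-1.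
Proof.
move=> x0; rewrite /Rintegral integral_itv_obnd_cbnd ?integral_expRN//.
apply/measurable_EFinP; apply: measurable_funTS; apply: continuous_measurable_fun.
by continuity.
Qed.

Lemma integrable_bounded_Laplace x (g : R -> R) (B : R) : 0 < x ->
  measurable_fun (D0 : set TR) g -> (forall t, D0 t -> `|g t| <= B) ->
  mu.-integrable D0 (EFin \o (fun t => expR (- (x * t)) * g t)).
Proof.
move=> x0 mg gB.
apply: (le_integrableR mD0 _ _ (integrableRZl B mD0 (integrable_Laplace0 x0))).
  apply: measurable_funM => //; apply: measurable_funTS.
  by apply: continuous_measurable_fun; continuity.
move=> t D0t; rewrite normrM (ger0_norm (expR_ge0 _)) mulrC.
by rewrite ler_wpM2r ?expR_ge0// gB.
Qed.

(** For [x <= y] the function [expR (- x t) - expR (- y t)] is nonnegative, with integral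
    [x^-1 - y^-1]. *)
Lemma Laplace_lipschitz x y (g : R -> R) (B : R) : 0 < x -> x <= y ->
  measurable_fun (D0 : set TR) g -> (forall t, D0 t -> `|g t| <= B) ->
  `|\int[mu]_(t in D0) (expR (- (x * t)) * g t)
    - \int[mu]_(t in D0) (expR (- (y * t)) * g t)| <= B * (x^-1 - y^-1).
Proof.
move=> x0 xy mg gB; have y0 : 0 < y by exact: lt_le_trans xy.
have Ix := integrable_bounded_Laplace x0 mg gB.
have Iy := integrable_bounded_Laplace y0 mg gB.
rewrite -(RintegralB mD0 Ix Iy).
have I := integrableRB mD0 Ix Iy.
apply: (le_trans (le_normr_Rintegral mD0 I)).
have Jx := integrable_Laplace0 x0; have Jy := integrable_Laplace0 y0.
rewrite -(Rintegral_Laplace0 x0) -(Rintegral_Laplace0 y0) -(RintegralB mD0 Jx Jy).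
have J := integrableRB mD0 Jx Jy.
rewrite -(RintegralZl B mD0 J).
apply: (le_Rintegral mD0 (integrableR_norm mD0 I) (integrableRZl B mD0 J)).
move=> t D0t; have t0 : 0 <= t.
  by move: D0t; rewrite /D0/= in_itv/= andbT => /ltW.
have d0 : 0 <= expR (- (x * t)) - expR (- (y * t)).
  by rewrite subr_ge0 ler_expR lerN2 ler_wpM2r.
by rewrite -mulrBl normrM (ger0_norm d0) mulrC ler_wpM2r// gB.
Qed.

Lemma Laplace_bound x (g : R -> R) (B : R) : 0 < x ->
  measurable_fun (D0 : set TR) g -> (forall t, D0 t -> `|g t| <= B) ->
  `|\int[mu]_(t in D0) (expR (- (x * t)) * g t)| <= B * x^-1.
Proof.
move=> x0 mg gB; have I := integrable_bounded_Laplace x0 mg gB.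
have J := integrable_Laplace0 x0.
apply: (le_trans (le_normr_Rintegral mD0 I)).
rewrite -(Rintegral_Laplace0 x0) -(RintegralZl B mD0 J).
apply: (le_Rintegral mD0 (integrableR_norm mD0 I) (integrableRZl B mD0 J)).
move=> t D0t; rewrite normrM (ger0_norm (expR_ge0 _)) mulrC.
by rewrite ler_wpM2r ?expR_ge0// gB.
Qed.

(** By the product formula this is the kernel of the index transform with its factor
    [expR x / pi] included. *)
Definition olevskii_laplace x tau : R := \int[mu]_(t in D0) (expR (- (x * t)) * olevskiiR tau t).

Lemma bessel_olevskii_laplace x tau : 0 < x ->
  expR x / pi * bessel_integral x tau ^+ 2 = olevskii_laplace x tau.
Proof.
move=> x0; rewrite bessel_integral_sqr// mulrA divfK ?gt_eqF ?pi_gt0//.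
rewrite /laplace_conical -RintegralZl//; last exact: integrable_laplace_conical.
rewrite /olevskii_laplace /Rintegral [in RHS]integral_itv_obnd_cbnd; last first.
  apply/measurable_EFinP; apply: measurable_funTS; apply: measurable_funM.
    by apply: continuous_measurable_fun; continuity.
  exact: measurable_olevskiiR2.
congr fine; apply: eq_integral => t _; congr (_%:E).
rewrite mulrA -expRD /olevskiiR; congr (expR _ * _); ring.
Qed.

Definition olevskiiR_transform phi t : R := \int[mu]_(tau in D0) (olevskiiR tau t * phi tau).

Section OneFunction.
Context (phi : R -> R) (Iphi : mu.-integrable D0 (EFin \o phi)).

Let mphi : measurable_fun (D0 : set TR) phi.
Proof. by apply/measurable_EFinP; case/integrableP: Iphi. Qed.

Definition L1norm : R := \int[mu]_(tau in D0) `|phi tau|.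

Lemma integrable_olevskiiR t : mu.-integrable D0 (EFin \o (fun tau => olevskiiR tau t * phi tau)).
Proof.
apply: (le_integrableR mD0 _ _ (integrableR_norm mD0 Iphi)).
  by apply: measurable_funM => //; apply: measurable_funTS; exact: measurable_olevskiiR1.
by move=> tau _; rewrite normrM -[leRHS]mul1r ler_wpM2r// normr_olevskiiR.
Qed.

Lemma normr_olevskiiR_transform t : `|olevskiiR_transform phi t| <= L1norm.
Proof.
have I := integrable_olevskiiR t.
apply: (le_trans (le_normr_Rintegral mD0 I)).
apply: (le_Rintegral mD0 (integrableR_norm mD0 I) (integrableR_norm mD0 Iphi)).
by move=> tau _; rewrite normrM -[leRHS]mul1r ler_wpM2r// normr_olevskiiR.
Qed.

Lemma L1norm_ge0 : 0 <= L1norm.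
Proof. by apply: le_trans (normr_olevskiiR_transform 0). Qed.

Let psi tau : R := \1_D0 tau * phi tau.

Let mpsi : measurable_fun [set: TR] psi.
Proof.
have := (measurable_restrictT phi mD0).1 mphi; apply: eq_measurable_fun => tau _.
by rewrite /psi patchE indicE; case: ifP => _; rewrite ?mul1r ?mul0r.
Qed.

Lemma integral_indic_scale (a : R) (g : R -> R) : mu.-integrable D0 (EFin \o g) ->
  (\int[mu]_t (a * (\1_D0 t * g t))%:E = (a * \int[mu]_(t in D0) g t)%:E)%E.
Proof.
move=> Ig; rewrite -(RintegralZl a mD0 Ig) /Rintegral fineK; last first.
  exact: (@integrable_fin_num _ _ R mu D0 mD0 _ (integrableRZl a mD0 Ig)).
rewrite [RHS]integral_indicM//; apply: eq_integral => t _.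
by rewrite -EFinM mulrCA.
Qed.

Let f x (z : TR * TR) : R :=
  psi z.1 * (\1_D0 z.2 * (expR (- (x * z.2)) * olevskiiR z.1 z.2)).

Let mf x : measurable_fun [set: TR * TR] (f x).
Proof.
apply: measurable_funM; first exact: measurableT_comp mpsi measurable_fst.
apply: measurable_funM.
  exact: measurableT_comp (measurable_indic mD0) measurable_snd.
by apply: measurable_funM; [measurability|exact: measurable_olevskiiR].
Qed.

Lemma integrable_laplace_olevskiiR x tau : 0 < x ->
  mu.-integrable D0 (EFin \o (fun t => expR (- (x * t)) * olevskiiR tau t)).
Proof.
move=> x0; apply: (@integrable_bounded_Laplace _ _ 1) => // [|t _].
  by apply: measurable_funTS; exact: measurable_olevskiiR2.
exact: normr_olevskiiR.
Qed.

Let integral_f2 x tau : 0 < x ->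
  (\int[mu]_t (f x (tau, t))%:E = (psi tau * olevskii_laplace x tau)%:E)%E.
Proof.
move=> x0.
exact: (integral_indic_scale (psi tau) (integrable_laplace_olevskiiR tau x0)).
Qed.

Let integral_f1 x t : 0 < x ->
  (\int[mu]_tau (f x (tau, t))%:E =
   (\1_D0 t * (expR (- (x * t)) * olevskiiR_transform phi t))%:E)%E.
Proof.
move=> x0; rewrite mulrA /olevskiiR_transform -(integral_indic_scale _ (integrable_olevskiiR t)).
by apply: eq_integral => tau _; congr (_%:E); rewrite /f /psi/=; ring.
Qed.

(** The Olevskii kernel is bounded by 1, so the integrand is dominated by
    [`|phi tau| * expR (- x t)]. *)
Let integrable_f x : 0 < x ->
  (mu \x mu)%E.-integrable [set: TR * TR] (EFin \o f x).
Proof.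
move=> x0; apply/(@integrable12ltyP _ _ TR TR R mu mu).
  by apply/measurable_EFinP; exact: mf.
have mabs : measurable_fun [set: TR * TR] (fun z => `|f x z|) by exact: measurableT_comp.
have M := @measurable_inner R _ TR setT _ measurableT mabs (fun z => normr_ge0 _).
have Iabs := integrableR_norm mD0 Iphi.
apply: (@le_lt_trans _ _ (x^-1 * \int[mu]_(tau in D0) `|phi tau|)%:E); last exact: ltry.
rewrite -(integral_indic_scale _ Iabs).
apply: (@ge0_le_integral _ _ R mu setT measurableT) => //.
- by move=> tau _; apply: integral_ge0 => t _.
- apply/measurable_EFinP; apply: measurable_funM => //.
  have : measurable_fun [set: TR] (fun tau => `|psi tau|) by exact: measurableT_comp.
  by apply: eq_measurable_fun => tau _; rewrite /psi normrM ger0_norm.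
- move=> tau _.
  have J := integrableR_norm mD0 (integrable_laplace_olevskiiR tau x0).
  have -> : (\int[mu]_t `|(EFin \o f x) (tau, t)| = \int[mu]_t (`|psi tau| *
      (\1_D0 t * `|expR (- (x * t)) * olevskiiR tau t|))%:E)%E.
    apply: eq_integral => t _; rewrite /= /f/=; congr (_%:E).
    by rewrite !normrM (ger0_norm (_ : 0 <= \1_D0 t)).
  rewrite (integral_indic_scale _ J) lee_fin mulrC.
  have -> : \1_D0 tau * `|phi tau| = `|psi tau| by rewrite /psi normrM ger0_norm.
  apply: ler_wpM2r => //; rewrite -(Rintegral_Laplace0 x0).
  apply: (le_Rintegral mD0 J (integrable_Laplace0 x0)) => t _.
  by rewrite normrM (ger0_norm (expR_ge0 _)) -[leRHS]mulr1 ler_wpM2l ?expR_ge0// normr_olevskiiR.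
Qed.

Lemma integrable_olevskii_laplace x : 0 < x ->
  mu.-integrable D0 (EFin \o (fun tau => olevskii_laplace x tau * phi tau)).
Proof.
move=> x0; have I := integrable_fubini_F (integrable_f x0).
have := @integrableS _ _ R mu setT D0 _ measurableT mD0 (@subsetT _ _) I.
apply: (@eq_integrable _ _ R mu D0 mD0) => tau; rewrite inE => D0tau.
by rewrite /fubini_F integral_f2//= /psi indicE mem_set// mul1r mulrC.
Qed.

(** Fubini's theorem gives measurability of the product with [expR (- t)], from which the
    exponential is then removed. *)
Lemma measurable_olevskiiR_transform : measurable_fun (D0 : set TR) (olevskiiR_transform phi).
Proof.
have M := measurable_fubini_G (integrable_f ltr01).
have mG : measurable_fun (D0 : set TR) (fun t => expR (- (1 * t)) * olevskiiR_transform phi t).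
  apply/measurable_EFinP; apply: (@eq_measurable_fun _ _ _ _ D0 _ _ _ (measurable_funTS M)).
  move=> t; rewrite inE => D0t; rewrite /fubini_G integral_f1//=.
  by rewrite indicE mem_set// [true%:R * _]mul1r.
have mE : measurable_fun (D0 : set TR) (fun t : R => expR t).
  by apply: measurable_funTS; apply: continuous_measurable_fun; exact: continuous_expR.
apply: (eq_measurable_fun _ _ (measurable_funM mE mG)) => t _ /=.
by rewrite mulrA -expRD mul1r addrN expR0 mul1r.
Qed.

Lemma integrable_laplace_transform x : 0 < x ->
  mu.-integrable D0 (EFin \o (fun t => expR (- (x * t)) * olevskiiR_transform phi t)).
Proof.
move=> x0; apply: (integrable_bounded_Laplace x0 measurable_olevskiiR_transform).
by move=> t _; exact: normr_olevskiiR_transform.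
Qed.

Lemma laplace_olevskii x : 0 < x ->
  \int[mu]_(tau in D0) (olevskii_laplace x tau * phi tau) =
  \int[mu]_(t in D0) (expR (- (x * t)) * olevskiiR_transform phi t).
Proof.
move=> x0; have F := Fubini (integrable_f x0).
have E1 := integral_indic_scale 1 (integrable_olevskii_laplace x0).
have E2 := integral_indic_scale 1 (integrable_laplace_transform x0).
rewrite !mul1r in E1 E2; apply: EFin_inj.
rewrite -[LHS]E1 -[RHS]E2; apply: etrans (etrans F _).
- apply: eq_integral => tau _; apply/esym; apply: etrans (integral_f2 tau x0) _.
  by rewrite /psi; congr (_%:E); ring.
- apply: eq_integral => t _; apply: etrans (integral_f1 t x0) _.
  by rewrite mul1r.
Qed.

End OneFunction.

End LaplaceOlevskii.

(** * Complex-valued functions *)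
Section Assembly.
Context {R : realType}.
Notation mu := (@lebesgue_measure R).
Notation TR := (measurableTypeR R).
Implicit Types (f g : R -> R[i]) (x t tau : R).
Let D0 : set R := `]0, +oo[.

Let mD0 : measurable (D0 : set TR). Proof. exact: measurable_itv. Qed.

Let D0_gt0 t : t \in D0 -> 0 < t.
Proof. by rewrite inE /D0/= in_itv/= andbT. Qed.

Lemma Re_realM (k : R) (z : R[i]) : complex.Re (k%:C * z) = k * complex.Re z.
Proof. by case: z => a b /=; rewrite mul0r subr0. Qed.

Lemma Im_realM (k : R) (z : R[i]) : complex.Im (k%:C * z) = k * complex.Im z.
Proof. by case: z => a b /=; rewrite mul0r addr0. Qed.

Definition re f tau : R := complex.Re (f tau).
Definition im f tau : R := complex.Im (f tau).

Definition integrable_parts f :=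
  mu.-integrable D0 (EFin \o re f) /\ mu.-integrable D0 (EFin \o im f).

Lemma in_L1_parts (w : R -> R) f : continuous w ->
  (forall tau, 0 < tau -> 1 <= w tau) -> in_L1 w f ->
  [/\ integrable_parts f,
      ((L1norm (re f))%:E <= L1_norm w f)%E & ((L1norm (im f))%:E <= L1_norm w f)%E].
Proof.
move=> cw w1 [[mr mi] fin].
have mr' : measurable_fun (D0 : set TR) (re f) by exact: mr.
have mi' : measurable_fun (D0 : set TR) (im f) by exact: mi.
have cmodE tau : cmod (f tau) = Num.sqrt (re f tau ^+ 2 + im f tau ^+ 2).
  by rewrite /cmod /re /im; case: (f tau).
have mw : measurable_fun (D0 : set TR) (fun tau => cmod (f tau) * w tau).
  apply: measurable_funM; last first.
    by apply: measurable_funTS; exact: continuous_measurable_fun.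
  rewrite (_ : (fun _ => _) = (@Num.sqrt R) \o (fun tau => re f tau ^+ 2 + im f tau ^+ 2)).
    apply: measurableT_comp; first exact: continuous_measurable_fun (@sqrt_continuous R).
    by apply: measurable_funD; exact: measurable_funX.
  by apply/funext => tau; rewrite cmodE.
have key (P : R -> R) : measurable_fun (D0 : set TR) P ->
    (forall tau, `|P tau| <= cmod (f tau)) ->
    mu.-integrable D0 (EFin \o P) /\ ((L1norm P)%:E <= L1_norm w f)%E.
  move=> mP Pf.
  have le : (\int[mu]_(tau in D0) `|P tau|%:E <= L1_norm w f)%E.
    apply: (@ge0_le_integral _ _ R mu D0 mD0) => //.
    - by apply/measurable_EFinP; exact: measurableT_comp.
    - exact/measurable_EFinP.
    - move=> tau; rewrite /D0/= in_itv/= andbT => tau0; rewrite lee_fin.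
      rewrite -[leLHS]mulr1; apply: ler_pM => //; exact: w1.
  have I : mu.-integrable D0 (EFin \o P).
    apply/integrableP; split; first exact/measurable_EFinP.
    exact: le_lt_trans le fin.
  split=> //; rewrite /L1norm /Rintegral fineK//.
  exact: (@integrable_fin_num _ _ R mu D0 mD0 _ (integrableR_norm mD0 I)).
have [I1 L1] := key _ mr' (fun tau => normr_Re_le (f tau)).
have [I2 L2] := key _ mi' (fun tau => normr_Im_le (f tau)).
by split.
Qed.

Lemma index_kernelE x tau : 0 < x ->
  index_kernel x tau = (pi / expR x * olevskii_laplace x tau)%:C.
Proof.
move=> x0; rewrite index_kernel_bessel -bessel_olevskii_laplace//; congr (_%:C).
have e0 : expR x != 0 by rewrite gt_eqF// expR_gt0.
have p0 : pi != 0 :> R by rewrite gt_eqF// pi_gt0.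
move: (expR x) (@pi R) e0 p0 => e p e0 p0; field.
by rewrite e0 p0.
Qed.

Lemma cintegrable_index x f : 0 < x -> integrable_parts f ->
  cintegrable D0 (fun tau => index_kernel x tau * f tau).
Proof.
move=> x0 [Ir Ii]; split.
- apply: (@eq_integrable _ _ R mu D0 mD0 _ _ _
    (integrableRZl (pi / expR x) mD0 (integrable_olevskii_laplace Ir x0))) => tau _ /=.
  by rewrite index_kernelE// Re_realM mulrA.
- apply: (@eq_integrable _ _ R mu D0 mD0 _ _ _
    (integrableRZl (pi / expR x) mD0 (integrable_olevskii_laplace Ii x0))) => tau _ /=.
  by rewrite index_kernelE// Im_realM mulrA.
Qed.

Lemma index_transform_parts x f : 0 < x -> integrable_parts f ->
  index_transform f x = (\int[mu]_(tau in D0) (olevskii_laplace x tau * re f tau)) +i*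
    (\int[mu]_(tau in D0) (olevskii_laplace x tau * im f tau)).
Proof.
move=> x0 [Ir Ii].
have key phi : mu.-integrable D0 (EFin \o phi) ->
    expR x / pi * (\int[mu]_(tau in D0) (pi / expR x * (olevskii_laplace x tau * phi tau))) =
    \int[mu]_(tau in D0) (olevskii_laplace x tau * phi tau).
  move=> I; rewrite (RintegralZl _ mD0 (integrable_olevskii_laplace I x0)) mulrA.
  by rewrite mulrA divfK ?gt_eqF ?pi_gt0// divff ?mul1r// gt_eqF// expR_gt0.
rewrite /index_transform /cintegral; apply/eqP; rewrite eq_complex/=.
rewrite !mul0r subr0 addr0 -(key _ Ir) -(key _ Ii).
apply/andP; split; apply/eqP; congr (_ * _); apply: eq_Rintegral => tau _.
  by rewrite index_kernelE// Re_realM mulrA.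
by rewrite index_kernelE// Im_realM mulrA.
Qed.

Lemma cintegrable_olevskii t f : 0 < t -> integrable_parts f ->
  cintegrable D0 (fun tau => olevskii_kernel t tau * f tau).
Proof.
move=> t0 [Ir Ii]; split.
- apply: (@eq_integrable _ _ R mu D0 mD0 _ _ _ (integrable_olevskiiR Ir t)) => tau _ /=.
  by rewrite olevskii_kernel_conical// Re_realM.
- apply: (@eq_integrable _ _ R mu D0 mD0 _ _ _ (integrable_olevskiiR Ii t)) => tau _ /=.
  by rewrite olevskii_kernel_conical// Im_realM.
Qed.

Lemma olevskii_transform_parts t f : 0 < t ->
  olevskii_transform f t = olevskiiR_transform (re f) t +i* olevskiiR_transform (im f) t.
Proof.
move=> t0; rewrite /olevskii_transform /cintegral; apply/eqP; rewrite eq_complex/=.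
apply/andP; split; apply/eqP; apply: eq_Rintegral => tau _.
  by rewrite olevskii_kernel_conical// Re_realM.
by rewrite olevskii_kernel_conical// Im_realM.
Qed.

Lemma cintegrable_laplace x f : 0 < x -> integrable_parts f ->
  cintegrable D0 (fun t => laplace_kernel x t * olevskii_transform f t).
Proof.
move=> x0 [Ir Ii]; split.
- apply: (@eq_integrable _ _ R mu D0 mD0 _ _ _ (integrable_laplace_transform Ir x0))
    => t /D0_gt0 t0.
  by rewrite Re_realM olevskii_transform_parts.
- apply: (@eq_integrable _ _ R mu D0 mD0 _ _ _ (integrable_laplace_transform Ii x0))
    => t /D0_gt0 t0.
  by rewrite Im_realM olevskii_transform_parts.
Qed.

Lemma index_transform_laplace x f : 0 < x -> integrable_parts f ->
  index_transform f x = laplace_transform (olevskii_transform f) x.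
Proof.
move=> x0 If; rewrite index_transform_parts//; case: If => Ir Ii.
rewrite !laplace_olevskii// /laplace_transform /cintegral.
congr (_ +i* _).
- apply: eq_Rintegral => t /D0_gt0 t0.
  by rewrite Re_realM olevskii_transform_parts.
- apply: eq_Rintegral => t /D0_gt0 t0.
  by rewrite Im_realM olevskii_transform_parts.
Qed.

Definition index_transformR phi x : R := \int[mu]_(tau in D0) (olevskii_laplace x tau * phi tau).

Lemma index_transformR_lipschitz phi x y : mu.-integrable D0 (EFin \o phi) ->
  0 < x -> 0 < y ->
  `|index_transformR phi x - index_transformR phi y| <= L1norm phi * `|x^-1 - y^-1|.
Proof.
move=> I x0 y0.
have key a b : 0 < a -> 0 < b -> a <= b ->
    `|index_transformR phi a - index_transformR phi b| <= L1norm phi * `|a^-1 - b^-1|.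
  move=> a0 b0 ab.
  have d0 : 0 <= a^-1 - b^-1 by rewrite subr_ge0 lef_pV2.
  rewrite /index_transformR !laplace_olevskii// (ger0_norm d0).
  apply: Laplace_lipschitz => //; first exact: measurable_olevskiiR_transform.
  by move=> t _; exact: normr_olevskiiR_transform.
have [xy|/ltW yx] := leP x y; first exact: key.
by rewrite distrC (le_trans (key _ _ y0 x0 yx))// distrC.
Qed.

Lemma index_transformR_bound phi x : mu.-integrable D0 (EFin \o phi) -> 0 < x ->
  `|index_transformR phi x| <= L1norm phi * x^-1.
Proof.
move=> I x0; rewrite /index_transformR laplace_olevskii//.
apply: Laplace_bound => //; first exact: measurable_olevskiiR_transform.
by move=> t _; exact: normr_olevskiiR_transform.
Qed.

(** As a function of [x^-1] the transform is Lipschitz. *)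
Lemma continuous_index_transformR phi x : mu.-integrable D0 (EFin \o phi) -> 0 < x ->
  {for x, continuous (index_transformR phi)}.
Proof.
move=> I x0; apply/cvgrPdist_lt => e e0.
have c : (fun y : R => L1norm phi * (x^-1 - y^-1)) @ x --> (0 : R).
  have <- : L1norm phi * (x^-1 - x^-1) = 0 by rewrite subrr mulr0.
  apply: cvgM; first exact: cvg_cst.
  by apply: cvgB; [exact: cvg_cst|apply: cvgV; [exact: lt0r_neq0|exact: cvg_id]].
have /cvgrPdist_lt/(_ _ e0) H := c.
apply: filterS2 (lt_nbhsr x0) H => y y0; rewrite sub0r normrN normrM ger0_norm ?L1norm_ge0// => h.
exact: le_lt_trans (index_transformR_lipschitz I x0 y0) h.
Qed.

Lemma in_C_index_transform (x0 : R) f : 0 < x0 -> integrable_parts f ->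
  in_C x0 (index_transform f).
Proof.
move=> x00 If; apply: (@continuous_in_subspaceT R R[i]^o) => x.
rewrite inE/= in_itv/= andbT => x0x; have x1 : 0 < x by exact: lt_le_trans x0x.
apply/cvg_complexP; rewrite (index_transform_parts x1 If); case: (If) => Ir Ii.
have pos := lt_nbhsr x1.
split.
- apply: cvg_trans (continuous_index_transformR Ir x1).
  apply: near_eq_cvg; apply: filterS pos => y y0.
  by rewrite (index_transform_parts y0 If).
- apply: cvg_trans (continuous_index_transformR Ii x1).
  apply: near_eq_cvg; apply: filterS pos => y y0.
  by rewrite (index_transform_parts y0 If).
Qed.

Lemma integrable_partsD (a : R[i]) f g : integrable_parts f -> integrable_parts g ->
  integrable_parts (fun tau => a * f tau + g tau).
Proof.
move=> [fr fi] [gr gi]; case: a => a b; split.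
- have I := integrableRD mD0
    (integrableRB mD0 (integrableRZl a mD0 fr) (integrableRZl b mD0 fi)) gr.
  apply: (@eq_integrable _ _ R mu D0 mD0 _ _ _ I) => tau _ /=.
  by rewrite /re /im; case: (f tau) => ? ?; case: (g tau).
- have I := integrableRD mD0
    (integrableRD mD0 (integrableRZl a mD0 fi) (integrableRZl b mD0 fr)) gi.
  apply: (@eq_integrable _ _ R mu D0 mD0 _ _ _ I) => tau _ /=.
  by rewrite /re /im; case: (f tau) => ? ?; case: (g tau).
Qed.

Lemma index_transform_linear (a : R[i]) f g x : 0 < x ->
  integrable_parts f -> integrable_parts g ->
  index_transform (fun tau => a * f tau + g tau) x =
  a * index_transform f x + index_transform g x.
Proof.
move=> x0 If Ig; rewrite !index_transform_parts//; last exact: integrable_partsD.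
case: If => fr fi; case: Ig => gr gi.
have Lfr := integrable_olevskii_laplace fr x0; have Lfi := integrable_olevskii_laplace fi x0.
have Lgr := integrable_olevskii_laplace gr x0; have Lgi := integrable_olevskii_laplace gi x0.
case: a => a b; apply/eqP; rewrite eq_complex/=; apply/andP; split; apply/eqP.
- have Z1 := integrableRZl a mD0 Lfr; have Z2 := integrableRZl b mD0 Lfi.
  rewrite -(RintegralZl a mD0 Lfr) -(RintegralZl b mD0 Lfi) -(RintegralB mD0 Z1 Z2).
  rewrite -(RintegralD mD0 (integrableRB mD0 Z1 Z2) Lgr).
  apply: eq_Rintegral => tau _; rewrite /re /im.
  by case: (f tau) => ? ?; case: (g tau) => ? ? /=; ring.
- have Z1 := integrableRZl a mD0 Lfi; have Z2 := integrableRZl b mD0 Lfr.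
  rewrite -(RintegralZl a mD0 Lfi) -(RintegralZl b mD0 Lfr) -(RintegralD mD0 Z1 Z2).
  rewrite -(RintegralD mD0 (integrableRD mD0 Z1 Z2) Lgi).
  apply: eq_Rintegral => tau _; rewrite /re /im.
  by case: (f tau) => ? ?; case: (g tau) => ? ? /=; ring.
Qed.

Lemma index_transform_bound f x : 0 < x -> integrable_parts f ->
  cmod (index_transform f x) <= (L1norm (re f) + L1norm (im f)) * x^-1.
Proof.
move=> x0 If; rewrite index_transform_parts//; case: If => Ir Ii.
apply: (le_trans (cmod_le _)) => /=; rewrite mulrDl.
by apply: lerD; exact: index_transformR_bound.
Qed.

End Assembly.

Theorem theorem4 (R : realType) (delta x0 : R)
    (hdelta0 : 0 <= delta) (hdelta1 : delta < pi / 2) (hx0 : 0 < x0) :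
  let w := fun tau : R => expR ((pi - 2 * delta) * tau) in
  bounded_L1_C w x0 index_transform /\
  forall f : R -> R[i], in_L1 w f ->
    [/\ forall x : R, 0 < x ->
          cintegrable `]0, +oo[ (fun tau => index_kernel x tau * f tau),
        forall t : R, 0 < t ->
          cintegrable `]0, +oo[ (fun tau => olevskii_kernel t tau * f tau)
      & forall x : R, 0 < x ->
          cintegrable `]0, +oo[
            (fun t => laplace_kernel x t * olevskii_transform f t) /\
          index_transform f x = laplace_transform (olevskii_transform f) x].
Proof.
move=> w.
have cw : continuous w by rewrite /w; continuity.
have w1 (tau : R) : 0 < tau -> 1 <= w tau.
  move=> tau0; apply: le_trans (expR_ge1Dx _); rewrite lerDl mulr_ge0 ?(ltW tau0)//.
  by rewrite subr_ge0 mulrC -ler_pdivlMr// ltW.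
have parts f (hf : in_L1 w f) := in_L1_parts cw w1 hf.
split.
  split.
  - by move=> f /parts[If _ _]; exact: in_C_index_transform.
  - move=> a f g /parts[If _ _] /parts[Ig _ _] x x0x.
    by apply: index_transform_linear => //; exact: lt_le_trans x0x.
  (* The real and the imaginary part each contribute at most [x0^-1] times the norm. *)
  - exists (2 * x0^-1) => f hf; have [If Lr Li] := parts f hf.
    apply: ge_ereal_sup => _ [x + <-]; rewrite /= in_itv/= andbT => x0x.
    have x1 : 0 < x by exact: lt_le_trans x0x.
    have fin : L1_norm w f \is a fin_num.
      rewrite ge0_fin_numE; first by case: hf.
      by apply: le_trans Lr; rewrite lee_fin L1norm_ge0//; case: If.
    rewrite -(fineK fin) in Lr Li *; rewrite -EFinM lee_fin.
    rewrite !lee_fin in Lr Li.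
    apply: (le_trans (index_transform_bound x1 If)).
    rewrite mulrAC; apply: ler_pM; rewrite ?invr_ge0 ?(ltW x1)//.
    + by case: If => ? ?; rewrite addr_ge0// L1norm_ge0.
    + by lra.
    + by rewrite lef_pV2.
move=> f /parts[If _ _]; split.
- by move=> x xpos; exact: cintegrable_index.
- by move=> t tpos; exact: cintegrable_olevskii.
- move=> x xpos; split; first exact: cintegrable_laplace.
  exact: index_transform_laplace.
Qed.
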